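(* Let $(\psi_1,\psi_2)\in\mathbb{C}^2\setminus\{(0,0)\}$ and let $(A_1(\tau),A_2(\tau))$ be the solution to $$ i\tfrac{d}{d\tau}A_1=|A_2|^2A_2,\qquad i\tfrac{d}{d\tau}A_2=|A_1|^2A_1,\qquad (A_1(0),A_2(0))=(\psi_1,\psi_2). $$ Let $\alpha:=2\sqrt{|\psi_1|^4+|\psi_2|^4}$, $\mathcal{R}_0:=2\operatorname{Re}(\overline{\psi_1}\psi_2)$, and $m:=\frac12-\frac{\mathcal{R}_0^2}{\alpha^2}\in[0,\frac12]$. If $\mathcal{R}_0\neq0$, then there exist real numbers $\theta_0,t_0$ determined by the initial data such that for all $\tau\in\mathbb{R}$ $$ A_1(\tau)=2^{-\frac34}\alpha^{\frac12}e^{i\theta_0}\sqrt{\operatorname{dn}(\alpha\tau+t_0,m)+\sqrt m\,\operatorname{sn}(\alpha\tau+t_0,m)}\;\exp\left(-i\frac{\mathcal{R}_0}{2}\int_0^\tau\frac{1-\sqrt m\,\operatorname{sd}(\alpha\sigma+t_0,m)}{1+\sqrt m\,\operatorname{sd}(\alpha\sigma+t_0,m)}\,d\sigma\right), $$ $$ A_2(\tau)=2^{-\frac14}\alpha^{-\frac12}e^{i\theta_0}\frac{\mathcal{R}_0+i\alpha\sqrt m\,\operatorname{cn}(\alpha\tau+t_0,m)}{\sqrt{\operatorname{dn}(\alpha\tau+t_0,m)+\sqrt m\,\operatorname{sn}(\alpha\tau+t_0,m)}}\;\exp\left(-i\frac{\mathcal{R}_0}{2}\int_0^\tau\frac{1-\sqrt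 m\,\operatorname{sd}(\alpha\sigma+t_0,m)}{1+\sqrt m\,\operatorname{sd}(\alpha\sigma+t_0,m)}\,d\sigma\right). $$ If $\mathcal{R}_0=0$, then there exist real numbers $\theta_0,t_0$ determined by the initial data such that for all $\tau\in\mathbb{R}$ $$ A_1(\tau)=2^{-1}\alpha^{\frac12}e^{i\theta_0}\operatorname{sn}\left(\tfrac12(\alpha\tau+t_0),\tfrac12\right)\sqrt{1+\operatorname{nd}(\alpha\tau+t_0,\tfrac12)}, $$ $$ A_2(\tau)=i\,2^{-1}\alpha^{\frac12}e^{i\theta_0}\operatorname{cd}\left(\tfrac12(\alpha\tau+t_0),\tfrac12\right)\sqrt{1+\operatorname{nd}(\alpha\tau+t_0,\tfrac12)}. $$ In particular, $$|A_1(\tau)|^4+|A_2(\tau)|^4=\alpha^2/4,\qquad 2\operatorname{Re}(\overline{A_1(\tau)}A_2(\tau))=\mathcal{R}_0$$ are independent of $\tau$.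
   Context: $\operatorname{sn}(t,m),\operatorname{cn}(t,m),\operatorname{dn}(t,m)$ are the Jacobi elliptic functions with parameter $m$ (the convention in which $\operatorname{sn}^2+\operatorname{cn}^2=1$ and $\operatorname{dn}^2+m\operatorname{sn}^2=1$, and $\frac{d}{dt}\operatorname{sn}=\operatorname{cn}\operatorname{dn}$); for $m=0$ they are $\sin t$, $\cos t$, $1$. Further $\operatorname{sd}=\operatorname{sn}/\operatorname{dn}$, $\operatorname{cd}=\operatorname{cn}/\operatorname{dn}$, $\operatorname{nd}=1/\operatorname{dn}$. *)

(* Defs.v *)
From Stdlib Require Export Reals.
From Coquelicot Require Export Coquelicot.

Open Scope R_scope.

(** * Jacobi elliptic functions, parameter convention *)

(** Legendre's incomplete integral of the first kind
    [F(phi | m) = int_0^phi dx / sqrt (1 - m sin^2 x)]. *)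
Definition ellipticF (phi m : R) : R :=
  RInt (fun x => / sqrt (1 - m * sin x ^ 2)) 0 phi.

(** The amplitude: the inverse of [phi |-> F(phi | m)].  That map is an
    increasing bijection of [R] when [m < 1], which is the only range of
    parameters for which these definitions are meaningful. *)
Definition jacobi_am (t m : R) : R :=
  iota (T := R_CompleteSpace) (fun phi : R => ellipticF phi m = t).

Definition sn (t m : R) : R := sin (jacobi_am t m).
Definition cn (t m : R) : R := cos (jacobi_am t m).
Definition dn (t m : R) : R := sqrt (1 - m * sn t m ^ 2).

Definition sd (t m : R) : R := sn t m / dn t m.
Definition cd (t m : R) : R := cn t m / dn t m.
Definition nd (t m : R) : R := 1 / dn t m.

(** * The initial value problem *)

Definition Cexp (z : C) : C :=
  (RtoC (exp (Re z)) * (cos (Im z), sin (Im z)))%C.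

(** [A1] and [A2] are differentiable on all of [R] as functions of a real
    variable, [C] being regarded as a real normed space. *)
Definition is_solution (psi1 psi2 : C) (A1 A2 : R -> C) : Prop :=
  (forall tau : R, exists dA1 dA2 : C,
     is_derive (K := R_AbsRing) (V := C_R_NormedModule) A1 tau dA1 /\
     is_derive (K := R_AbsRing) (V := C_R_NormedModule) A2 tau dA2 /\
     (Ci * dA1 = RtoC (Cmod (A2 tau) ^ 2) * A2 tau)%C /\
     (Ci * dA2 = RtoC (Cmod (A1 tau) ^ 2) * A1 tau)%C) /\
  A1 0 = psi1 /\ A2 0 = psi2.

(* Main.v *)
Require Import Defs.
From Stdlib Require Import Reals.
From Coquelicot Require Import Coquelicot.
From Stdlib Require Import Lra Psatz Ranalysis5.

Open Scope R_scope.

(** The right-hand side of the system is locally Lipschitz and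
    [|A1|^4 + |A2|^4] is conserved, so solutions stay bounded and a Gronwall
    argument ([gronwall_zero], [real_system_unique]) shows that they are
    determined by their initial values.  It is therefore enough to exhibit, for
    every initial condition, one solution of the announced form.

    Both forms are instances of one ansatz, in which the common phase
    [theta] is factored out:
    [A1 = r exp (i theta)], [A2 = (p + i q) exp (i theta)] with real [r, p, q].
    The system becomes
    [r' = (p^2 + q^2) q],  [r theta' = - (p^2 + q^2) p],
    [p' = q theta'],  [q' = - r^3 - p theta']  ([rotating_real_system]).

    When [R0 <> 0], write [G = dn + sqrt m sn] and [H = dn - sqrt m sn].  With a
    suitable scale [k], [|A1|^2 = k^2 G], [|A2|^2 = k^2 H] and
    [2 Im (conj A1 * A2) = alpha sqrt m cn].  Everything then follows from
    [G' = sqrt m cn H] and from [R0^2 + alpha^2 m cn^2 = (alpha^2 / 2) G H],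
    which is the identity [|conj A1 * A2|^2 = |A1|^2 |A2|^2]
    ([solution_nonzero_overlap]).  Since [m < 1/2], both [G] and [H] are
    positive.  The initial data fix the amplitude of [t0] by its sine and cosine
    ([nonzero_overlap_initial]).

    When [R0 = 0], the vectors [psi1] and [psi2] are orthogonal in the plane, so
    [p = 0], [theta] is constant, and what remains is the planar system
    [r' = q^3], [q' = - r^3] on a curve [r^4 + q^4 = const].  It is solved by
    [r = k sn dn / D], [q = k cn / D] with [D^2 = 1 - sn^2 + sn^4 / 2] at
    [m = 1/2] ([solution_zero_overlap]); the duplication formula for [dn]
    ([dn_double]) turns [dn / D] at [t] into [sqrt (1 + nd (2 t))] up to the
    factor [sqrt 2].  This pair covers the whole curve
    ([quartic_curve_parametrization]), hence all initial data.

    The derivatives of [sn, cn, dn] come from inverting the strictly increasing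
    function [F (. | m)], whose derivative is at least 1. *)

(** * Angles *)

Lemma exists_angle : forall s c : R, s ^ 2 + c ^ 2 = 1 ->
  exists phi : R, sin phi = s /\ cos phi = c.
Proof.
  intros s c H.
  assert (Hc : -1 <= c <= 1) by nra.
  assert (Hs : sqrt (1 - Rsqr c) = Rabs s).
  { rewrite <- sqrt_Rsqr_abs. f_equal. unfold Rsqr. lra. }
  destruct (Rle_dec 0 s) as [h | h].
  - exists (acos c). rewrite sin_acos, cos_acos by assumption.
    rewrite Hs, Rabs_pos_eq by lra. auto.
  - exists (- acos c). rewrite sin_neg, cos_neg, sin_acos, cos_acos by assumption.
    rewrite Hs, Rabs_left by lra. split; lra.
Qed.

(** The radius may be zero, with an arbitrary angle.  This matters for the
    amplitude of [t0] when [m = 0]. *)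
Lemma polar_coordinates : forall rho s c : R, 0 <= rho -> s ^ 2 + c ^ 2 = rho ^ 2 ->
  exists phi : R, rho * sin phi = s /\ rho * cos phi = c.
Proof.
  intros rho s c Hrho H. destruct (Req_dec rho 0) as [-> | Hne].
  - exists 0. rewrite !Rmult_0_l.
    pose proof (pow2_ge_0 s). pose proof (pow2_ge_0 c).
    split; symmetry; apply Rsqr_eq_0; rewrite Rsqr_pow2; lra.
  - destruct (exists_angle (s / rho) (c / rho)) as [phi [Hs Hc]].
    + replace ((s / rho) ^ 2 + (c / rho) ^ 2) with ((s ^ 2 + c ^ 2) / rho ^ 2)
        by (field; assumption).
      rewrite H. field. assumption.
    + exists phi. rewrite Hs, Hc. split; field; assumption.
Qed.

(** * Inverting the incomplete elliptic integral *)

Lemma dn_radicand_pos : forall m x : R, 0 <= m < 1 -> 0 < 1 - m * sin x ^ 2 <= 1.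
Proof.
  intros m x Hm. pose proof (sin2_cos2 x) as H. unfold Rsqr in H. nra.
Qed.

Lemma is_derive_ellipticF : forall m phi : R, 0 <= m < 1 ->
  is_derive (fun x => ellipticF x m) phi (/ sqrt (1 - m * sin phi ^ 2)).
Proof.
  intros m phi Hm.
  assert (Hc : forall x, continuous (fun x => / sqrt (1 - m * sin x ^ 2)) x).
  { intros x. pose proof (dn_radicand_pos m x Hm).
    apply (ex_derive_continuous (fun x => / sqrt (1 - m * sin x ^ 2))).
    auto_derive. simpl in *. split; [lra | split; [ | exact I]].
    apply Rgt_not_eq, sqrt_lt_R0. lra. }
  apply (is_derive_RInt (fun x => / sqrt (1 - m * sin x ^ 2)) _ 0 phi).
  - apply filter_forall. intros y. apply (RInt_correct (V := R_CompleteNormedModule)).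
    apply ex_RInt_continuous. auto.
  - apply Hc.
Qed.

(** For [0 <= m] the integrand is at least 1.  This one estimate makes [F]
    injective, makes it surjective, and makes its inverse 1-Lipschitz. *)
Lemma ellipticF_expands : forall m a b : R, 0 <= m < 1 -> a <= b ->
  b - a <= ellipticF b m - ellipticF a m.
Proof.
  intros m a b Hm Hab.
  destruct (MVT_gen (fun x => ellipticF x m) a b
              (fun x => / sqrt (1 - m * sin x ^ 2))) as [c [_ Hc]].
  - intros x _. now apply is_derive_ellipticF.
  - intros x _. apply continuity_pt_filterlim.
    apply (ex_derive_continuous (fun x => ellipticF x m)).
    eexists. now apply is_derive_ellipticF.
  - rewrite Hc. pose proof (dn_radicand_pos m c Hm) as Hr.
    assert (0 < sqrt (1 - m * sin c ^ 2)) by (apply sqrt_lt_R0; lra).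
    assert (sqrt (1 - m * sin c ^ 2) <= 1).
    { replace 1 with (sqrt 1) at 2 by apply sqrt_1. apply sqrt_le_1_alt. lra. }
    assert (1 <= / sqrt (1 - m * sin c ^ 2)).
    { replace 1 with (/ 1) at 1 by apply Rinv_1. apply Rinv_le_contravar; lra. }
    nra.
Qed.

Lemma ellipticF_injective : forall m a b : R, 0 <= m < 1 ->
  ellipticF a m = ellipticF b m -> a = b.
Proof.
  intros m a b Hm H. destruct (Rle_dec a b).
  - pose proof (ellipticF_expands m a b Hm ltac:(lra)). lra.
  - pose proof (ellipticF_expands m b a Hm ltac:(lra)). lra.
Qed.

Lemma ellipticF_surjective : forall m t : R, 0 <= m < 1 ->
  exists phi : R, ellipticF phi m = t.
Proof.
  intros m t Hm.
  assert (H0 : ellipticF 0 m = 0) by (unfold ellipticF; apply (RInt_point (V := R_CompleteNormedModule))).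
  pose proof (Rle_abs t). pose proof (Rle_abs (- t)) as Ht. rewrite Rabs_Ropp in Ht.
  pose proof (Rabs_pos t).
  pose proof (ellipticF_expands m 0 (Rabs t) Hm ltac:(lra)).
  pose proof (ellipticF_expands m (- Rabs t) 0 Hm ltac:(lra)).
  destruct (IVT_gen (fun x => ellipticF x m) (- Rabs t) (Rabs t) t) as [x [_ Hx]].
  - intros x. apply continuity_pt_filterlim.
    apply (ex_derive_continuous (fun x => ellipticF x m)).
    eexists. now apply is_derive_ellipticF.
  - rewrite Rmin_left, Rmax_right by lra. lra.
  - now exists x.
Qed.

Lemma jacobi_am_ellipticF : forall m phi : R, 0 <= m < 1 ->
  jacobi_am (ellipticF phi m) m = phi.
Proof.
  intros m phi Hm. unfold jacobi_am.
  apply (iota_unique (V := R_CompleteNormedModule)); [ | reflexivity].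
  intros y Hy. now apply (ellipticF_injective m).
Qed.

Lemma ellipticF_jacobi_am : forall m t : R, 0 <= m < 1 ->
  ellipticF (jacobi_am t m) m = t.
Proof.
  intros m t Hm. destruct (ellipticF_surjective m t Hm) as [phi <-].
  now rewrite jacobi_am_ellipticF.
Qed.

Lemma jacobi_am_lipschitz : forall m t u : R, 0 <= m < 1 ->
  Rabs (jacobi_am t m - jacobi_am u m) <= Rabs (t - u).
Proof.
  intros m t u Hm.
  rewrite <- (ellipticF_jacobi_am m t Hm) at 2.
  rewrite <- (ellipticF_jacobi_am m u Hm) at 2.
  set (a := jacobi_am t m). set (b := jacobi_am u m).
  destruct (Rle_dec a b).
  - pose proof (ellipticF_expands m a b Hm ltac:(lra)).
    rewrite !Rabs_left1; lra.
  - pose proof (ellipticF_expands m b a Hm ltac:(lra)).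
    rewrite !Rabs_pos_eq; lra.
Qed.

(** The derivative of the inverse of [F] at [t] is the reciprocal of
    [F' = 1 / sqrt (1 - m sin^2)], taken at the amplitude of [t]. *)
Lemma is_derive_jacobi_am : forall m t : R, 0 <= m < 1 ->
  is_derive (fun x => jacobi_am x m) t (dn t m).
Proof.
  intros m t Hm.
  pose (g := fun x => jacobi_am x m).
  assert (Hd : forall a, derivable_pt (fun x => ellipticF x m) a).
  { intros a. eexists. apply is_derive_Reals. now apply is_derive_ellipticF. }
  assert (Hcont : continuity_pt g t).
  { intros eps Heps. exists eps. split; [exact Heps | ]. intros x [_ Hx].
    eapply Rle_lt_trans; [ | exact Hx].
    now apply jacobi_am_lipschitz. }
  assert (Hincr : g (t - 1) <= g t <= g (t + 1)).
  { assert (Hmono : forall a b, a <= b -> g a <= g b).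
    { intros a b Hab. destruct (Rle_dec (g a) (g b)) as [h | h]; [exact h | ].
      pose proof (ellipticF_expands m (g b) (g a) Hm ltac:(lra)) as He.
      unfold g in He, h. rewrite !ellipticF_jacobi_am in He by assumption. lra. }
    split; apply Hmono; lra. }
  pose proof (dn_radicand_pos m (g t) Hm) as Hr.
  assert (Hdn : 0 < sqrt (1 - m * sin (g t) ^ 2)) by (apply sqrt_lt_R0; lra).
  assert (Heq : derive_pt (fun x => ellipticF x m) (g t) (Hd (g t))
                = / sqrt (1 - m * sin (g t) ^ 2)).
  { apply derive_pt_eq_0, is_derive_Reals. now apply is_derive_ellipticF. }
  apply is_derive_Reals.
  replace (dn t m) with (1 / derive_pt (fun x => ellipticF x m) (g t) (Hd (g t))).
  - apply (derivable_pt_lim_recip_interv (fun x => ellipticF x m) g (t - 1) (t + 1) t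
             (fun a _ => Hd a) Hcont ltac:(lra) ltac:(lra) Hincr).
    + intros x _. apply ellipticF_jacobi_am, Hm.
    + cbv beta. rewrite Heq. apply Rgt_not_eq, Rinv_0_lt_compat, Hdn.
  - rewrite Heq. unfold dn, sn. fold (g t). field. lra.
Qed.

Lemma sn2_cn2 : forall t m : R, sn t m ^ 2 + cn t m ^ 2 = 1.
Proof.
  intros t m. pose proof (sin2_cos2 (jacobi_am t m)) as H.
  unfold Rsqr in H. unfold sn, cn. lra.
Qed.

Lemma dn_sqr : forall t m : R, 0 <= m < 1 -> dn t m ^ 2 = 1 - m * sn t m ^ 2.
Proof.
  intros t m Hm. unfold dn. rewrite pow2_sqrt; [reflexivity | ].
  pose proof (dn_radicand_pos m (jacobi_am t m) Hm). unfold sn. lra.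
Qed.

Lemma dn_pos : forall t m : R, 0 <= m < 1 -> 0 < dn t m.
Proof.
  intros t m Hm. apply sqrt_lt_R0.
  pose proof (dn_radicand_pos m (jacobi_am t m) Hm). unfold sn. lra.
Qed.

Lemma is_derive_sn : forall m t : R, 0 <= m < 1 ->
  is_derive (fun x => sn x m) t (cn t m * dn t m).
Proof.
  intros m t Hm. pose proof (is_derive_jacobi_am m t Hm) as H.
  unfold sn, cn. auto_derive.
  - eexists; exact H.
  - rewrite (is_derive_unique (fun x : R => jacobi_am x m) t _ H). ring.
Qed.

Lemma is_derive_cn : forall m t : R, 0 <= m < 1 ->
  is_derive (fun x => cn x m) t (- (sn t m * dn t m)).
Proof.
  intros m t Hm. pose proof (is_derive_jacobi_am m t Hm) as H.
  unfold sn, cn. auto_derive.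
  - eexists; exact H.
  - rewrite (is_derive_unique (fun x : R => jacobi_am x m) t _ H). ring.
Qed.

Lemma is_derive_dn : forall m t : R, 0 <= m < 1 ->
  is_derive (fun x => dn x m) t (- (m * (sn t m * cn t m))).
Proof.
  intros m t Hm. pose proof (is_derive_sn m t Hm) as H.
  pose proof (dn_pos t m Hm) as Hp. pose proof (dn_sqr t m Hm) as Hs.
  unfold dn at 1. auto_derive.
  - split; [eexists; exact H | ]. split; [ | exact I].
    replace (1 + - (m * (sn t m * (sn t m * 1)))) with (dn t m ^ 2) by (rewrite Hs; ring).
    apply pow_lt, Hp.
  - rewrite (is_derive_unique (fun x : R => sn x m) t _ H).
    replace (sqrt (1 + - (m * (sn t m * (sn t m * 1))))) with (dn t m) by reflexivity.
    field. lra.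
Qed.

(** * Conserved quantities and uniqueness *)

Lemma is_derive_value : forall (f : R -> R) (t l l' : R),
  is_derive f t l -> l = l' -> is_derive f t l'.
Proof. intros f t l l' H <-. exact H. Qed.

Lemma derivable_mean_value : forall f df : R -> R, (forall t, is_derive f t (df t)) ->
  forall a b, exists c, f b - f a = df c * (b - a).
Proof.
  intros f df H a b. destruct (MVT_gen f a b df) as [c [_ Hc]].
  - auto.
  - intros x _. apply continuity_pt_filterlim.
    apply (ex_derive_continuous f). eexists. apply H.
  - now exists c.
Qed.

Lemma constant_of_derive_zero : forall f : R -> R, (forall t, is_derive f t 0) ->
  forall t, f t = f 0.
Proof.
  intros f H t. destruct (derivable_mean_value f (fun _ => 0) H 0 t) as [c Hc]. lra.
Qed.

(** The bound makes [E (t) exp (- K t)] nonincreasing and [E (t) exp (K t)]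
    nondecreasing, so that [E] vanishes on either side of its zero at 0. *)
Lemma gronwall_zero : forall (E dE : R -> R) (K : R),
  (forall t, is_derive E t (dE t)) -> (forall t, 0 <= E t) ->
  (forall t, Rabs (dE t) <= K * E t) -> E 0 = 0 -> forall t, E t = 0.
Proof.
  intros E dE K Hd Hpos Hbound H0 t.
  assert (Hdamp : forall k s, is_derive (fun x => E x * exp (k * x)) s
                                ((dE s + k * E s) * exp (k * s))).
  { intros k s. pose proof (Hd s) as Hs. auto_derive.
    - eexists; exact Hs.
    - rewrite (is_derive_unique (fun x : R => E x) s _ Hs). ring. }
  apply Rle_antisym; [ | apply Hpos].
  destruct (Rle_dec 0 t) as [h | h].
  - destruct (derivable_mean_value _ _ (Hdamp (- K)) 0 t) as [c Hc].
    rewrite H0, Rmult_0_l, !Rminus_0_r in Hc.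
    pose proof (Rle_trans _ _ _ (Rle_abs _) (Hbound c)).
    pose proof (exp_pos (- K * t)). pose proof (exp_pos (- K * c)).
    assert ((dE c + - K * E c) * exp (- K * c) <= 0) by nra.
    nra.
  - destruct (derivable_mean_value _ _ (Hdamp K) 0 t) as [c Hc].
    rewrite H0, Rmult_0_l, !Rminus_0_r in Hc.
    pose proof (Rle_trans _ _ _ (Rabs_maj2 _) (Hbound c)).
    pose proof (exp_pos (K * t)). pose proof (exp_pos (K * c)).
    assert (0 <= (dE c + K * E c) * exp (K * c)) by nra.
    nra.
Qed.

(** The system for [A1 = x1 + i y1] and [A2 = x2 + i y2]. *)
Definition real_system (x1 y1 x2 y2 : R -> R) : Prop := forall t : R,
  is_derive x1 t ((x2 t ^ 2 + y2 t ^ 2) * y2 t) /\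
  is_derive y1 t (- ((x2 t ^ 2 + y2 t ^ 2) * x2 t)) /\
  is_derive x2 t ((x1 t ^ 2 + y1 t ^ 2) * y1 t) /\
  is_derive y2 t (- ((x1 t ^ 2 + y1 t ^ 2) * x1 t)).

Lemma is_derive_Re : forall (f : R -> C) (t : R) (l : C),
  is_derive (K := R_AbsRing) (V := C_R_NormedModule) f t l ->
  is_derive (fun x => Re (f x)) t (Re l).
Proof.
  intros f t l H.
  exact (filterdiff_comp' (V := C_R_NormedModule) f (fun z : C => fst z) t
           (fun y => scal y l) (fun z : C => fst z) H
           (filterdiff_linear _ (is_linear_fst (U := R_NormedModule) (V := R_NormedModule)))).
Qed.

Lemma is_derive_Im : forall (f : R -> C) (t : R) (l : C),
  is_derive (K := R_AbsRing) (V := C_R_NormedModule) f t l ->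
  is_derive (fun x => Im (f x)) t (Im l).
Proof.
  intros f t l H.
  exact (filterdiff_comp' (V := C_R_NormedModule) f (fun z : C => snd z) t
           (fun y => scal y l) (fun z : C => snd z) H
           (filterdiff_linear _ (is_linear_snd (U := R_NormedModule) (V := R_NormedModule)))).
Qed.

Lemma Cmod_sqr : forall z : C, Cmod z ^ 2 = Re z ^ 2 + Im z ^ 2.
Proof.
  intros z. unfold Cmod. rewrite pow2_sqrt; [reflexivity | ].
  unfold Re, Im. nra.
Qed.

Lemma Cmod_pow4 : forall z : C, Cmod z ^ 4 = (Re z ^ 2 + Im z ^ 2) ^ 2.
Proof. intros z. rewrite <- Cmod_sqr. ring. Qed.

Lemma real_system_of_solution : forall psi1 psi2 A1 A2, is_solution psi1 psi2 A1 A2 ->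
  real_system (fun t => Re (A1 t)) (fun t => Im (A1 t))
              (fun t => Re (A2 t)) (fun t => Im (A2 t)).
Proof.
  intros psi1 psi2 A1 A2 [H _] t. destruct (H t) as (d1 & d2 & H1 & H2 & E1 & E2).
  assert (R1 := f_equal Re E1). assert (I1 := f_equal Im E1).
  assert (R2 := f_equal Re E2). assert (I2 := f_equal Im E2).
  rewrite Cmod_sqr in R1, I1, R2, I2.
  assert (HRe1 := is_derive_Re _ _ _ H1). assert (HIm1 := is_derive_Im _ _ _ H1).
  assert (HRe2 := is_derive_Re _ _ _ H2). assert (HIm2 := is_derive_Im _ _ _ H2).
  unfold Re, Im in *. simpl in R1, I1, R2, I2.
  split; [ | split; [ | split]].
  - apply (is_derive_value _ _ _ _ HRe1). lra.
  - apply (is_derive_value _ _ _ _ HIm1). lra.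
  - apply (is_derive_value _ _ _ _ HRe2). lra.
  - apply (is_derive_value _ _ _ _ HIm2). lra.
Qed.

(** The second invariant is [Re (conj A1 * A2)]: the derivative of
    [conj A1 * A2] is [i (|A2|^4 - |A1|^4)], which is purely imaginary. *)
Lemma real_system_invariants : forall x1 y1 x2 y2, real_system x1 y1 x2 y2 ->
  forall t,
    (x1 t ^ 2 + y1 t ^ 2) ^ 2 + (x2 t ^ 2 + y2 t ^ 2) ^ 2
      = (x1 0 ^ 2 + y1 0 ^ 2) ^ 2 + (x2 0 ^ 2 + y2 0 ^ 2) ^ 2 /\
    x1 t * x2 t + y1 t * y2 t = x1 0 * x2 0 + y1 0 * y2 0.
Proof.
  intros x1 y1 x2 y2 H t. split.
  - apply (constant_of_derive_zero
      (fun t => (x1 t ^ 2 + y1 t ^ 2) ^ 2 + (x2 t ^ 2 + y2 t ^ 2) ^ 2)).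
    intros s. destruct (H s) as (Hx1 & Hy1 & Hx2 & Hy2). auto_derive.
    + repeat split; eexists; eassumption.
    + rewrite (is_derive_unique (fun x : R => x1 x) s _ Hx1),
        (is_derive_unique (fun x : R => y1 x) s _ Hy1),
        (is_derive_unique (fun x : R => x2 x) s _ Hx2),
        (is_derive_unique (fun x : R => y2 x) s _ Hy2). ring.
  - apply (constant_of_derive_zero (fun t => x1 t * x2 t + y1 t * y2 t)).
    intros s. destruct (H s) as (Hx1 & Hy1 & Hx2 & Hy2). auto_derive.
    + repeat split; eexists; eassumption.
    + rewrite (is_derive_unique (fun x : R => x1 x) s _ Hx1),
        (is_derive_unique (fun x : R => y1 x) s _ Hy1),
        (is_derive_unique (fun x : R => x2 x) s _ Hx2),
        (is_derive_unique (fun x : R => y2 x) s _ Hy2). ring.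
Qed.

(** The Lipschitz estimate for the map [z |-> |z|^2 z], coordinate by
    coordinate; exchanging the two coordinates gives the other component. *)
Lemma cubic_lipschitz : forall a b c d M,
  a ^ 2 + b ^ 2 <= M -> c ^ 2 + d ^ 2 <= M ->
  Rabs ((a ^ 2 + b ^ 2) * b - (c ^ 2 + d ^ 2) * d)
    <= 3 * M * (Rabs (a - c) + Rabs (b - d)).
Proof.
  intros a b c d M Hab Hcd.
  replace ((a ^ 2 + b ^ 2) * b - (c ^ 2 + d ^ 2) * d)
    with (((a + c) * d) * (a - c) + (a ^ 2 + b ^ 2 + (b + d) * d) * (b - d)) by ring.
  eapply Rle_trans; [apply Rabs_triang | ]. rewrite !Rabs_mult.
  assert (H1 : Rabs (a + c) * Rabs d <= 3 * M).
  { rewrite <- Rabs_mult.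
    pose proof (pow2_ge_0 a). pose proof (pow2_ge_0 b). pose proof (pow2_ge_0 c).
    pose proof (pow2_ge_0 (a - d)). pose proof (pow2_ge_0 (c - d)).
    pose proof (pow2_ge_0 (a + d)). pose proof (pow2_ge_0 (c + d)).
    apply Rabs_le. split; lra. }
  assert (H2 : Rabs (a ^ 2 + b ^ 2 + (b + d) * d) <= 3 * M).
  { pose proof (pow2_ge_0 a). pose proof (pow2_ge_0 b). pose proof (pow2_ge_0 c).
    pose proof (pow2_ge_0 (b - d)). pose proof (pow2_ge_0 (b + d)).
    apply Rabs_le. split; lra. }
  pose proof (Rabs_pos (a - c)). pose proof (Rabs_pos (b - d)). nra.
Qed.

Lemma real_system_bounded : forall x1 y1 x2 y2, real_system x1 y1 x2 y2 ->
  exists M, forall t, x1 t ^ 2 + y1 t ^ 2 <= M /\ x2 t ^ 2 + y2 t ^ 2 <= M.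
Proof.
  intros x1 y1 x2 y2 H.
  exists (1 + (x1 0 ^ 2 + y1 0 ^ 2) ^ 2 + (x2 0 ^ 2 + y2 0 ^ 2) ^ 2).
  intros t. destruct (real_system_invariants _ _ _ _ H t) as [He _].
  set (X := x1 t ^ 2 + y1 t ^ 2) in *. set (Y := x2 t ^ 2 + y2 t ^ 2) in *.
  split; nra.
Qed.

(** The squared distance [E] of two solutions satisfies [|E'| <= K E], where
    [K] comes from a common bound on the two trajectories. *)
Lemma real_system_unique : forall x1 y1 x2 y2 u1 v1 u2 v2,
  real_system x1 y1 x2 y2 -> real_system u1 v1 u2 v2 ->
  x1 0 = u1 0 -> y1 0 = v1 0 -> x2 0 = u2 0 -> y2 0 = v2 0 ->
  forall t, x1 t = u1 t /\ y1 t = v1 t /\ x2 t = u2 t /\ y2 t = v2 t.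
Proof.
  intros x1 y1 x2 y2 u1 v1 u2 v2 Hx Hu I1 I2 I3 I4 t.
  destruct (real_system_bounded _ _ _ _ Hx) as [M1 HM1].
  destruct (real_system_bounded _ _ _ _ Hu) as [M2 HM2].
  set (M := Rmax M1 M2).
  assert (HxM : forall t, x1 t ^ 2 + y1 t ^ 2 <= M /\ x2 t ^ 2 + y2 t ^ 2 <= M).
  { intros s. pose proof (Rmax_l M1 M2). destruct (HM1 s). unfold M. lra. }
  assert (HuM : forall t, u1 t ^ 2 + v1 t ^ 2 <= M /\ u2 t ^ 2 + v2 t ^ 2 <= M).
  { intros s. pose proof (Rmax_r M1 M2). destruct (HM2 s). unfold M. lra. }
  pose (E := fun t => (x1 t - u1 t) ^ 2 + (y1 t - v1 t) ^ 2
                      + ((x2 t - u2 t) ^ 2 + (y2 t - v2 t) ^ 2)).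
  pose (dE := fun t => 2 *
    ((x1 t - u1 t) * ((x2 t ^ 2 + y2 t ^ 2) * y2 t - (u2 t ^ 2 + v2 t ^ 2) * v2 t)
     - (y1 t - v1 t) * ((y2 t ^ 2 + x2 t ^ 2) * x2 t - (v2 t ^ 2 + u2 t ^ 2) * u2 t)
     + (x2 t - u2 t) * ((x1 t ^ 2 + y1 t ^ 2) * y1 t - (u1 t ^ 2 + v1 t ^ 2) * v1 t)
     - (y2 t - v2 t) * ((y1 t ^ 2 + x1 t ^ 2) * x1 t - (v1 t ^ 2 + u1 t ^ 2) * u1 t))).
  assert (HE : E t = 0).
  { apply (gronwall_zero E dE (24 * M)).
    - intros s. destruct (Hx s) as (A1 & A2 & A3 & A4).
      destruct (Hu s) as (B1 & B2 & B3 & B4). unfold E, dE. auto_derive.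
      + repeat split; eexists; eassumption.
      + rewrite (is_derive_unique (fun x : R => x1 x) s _ A1),
          (is_derive_unique (fun x : R => y1 x) s _ A2),
          (is_derive_unique (fun x : R => x2 x) s _ A3),
          (is_derive_unique (fun x : R => y2 x) s _ A4),
          (is_derive_unique (fun x : R => u1 x) s _ B1),
          (is_derive_unique (fun x : R => v1 x) s _ B2),
          (is_derive_unique (fun x : R => u2 x) s _ B3),
          (is_derive_unique (fun x : R => v2 x) s _ B4). ring.
    - intros s. unfold E. pose proof (pow2_ge_0 (x1 s - u1 s)).
      pose proof (pow2_ge_0 (y1 s - v1 s)). pose proof (pow2_ge_0 (x2 s - u2 s)).
      pose proof (pow2_ge_0 (y2 s - v2 s)). lra.
    - intros s. unfold E, dE. destruct (HxM s) as [X1 X2], (HuM s) as [U1 U2].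
      pose proof (cubic_lipschitz (x2 s) (y2 s) (u2 s) (v2 s) M X2 U2) as L1.
      pose proof (cubic_lipschitz (y2 s) (x2 s) (v2 s) (u2 s) M ltac:(lra) ltac:(lra)) as L2.
      pose proof (cubic_lipschitz (x1 s) (y1 s) (u1 s) (v1 s) M X1 U1) as L3.
      pose proof (cubic_lipschitz (y1 s) (x1 s) (v1 s) (u1 s) M ltac:(lra) ltac:(lra)) as L4.
      rewrite <- (pow2_abs (x1 s - u1 s)), <- (pow2_abs (y1 s - v1 s)),
        <- (pow2_abs (x2 s - u2 s)), <- (pow2_abs (y2 s - v2 s)).
      assert (HM : 0 <= M)
        by (pose proof (pow2_ge_0 (x1 s)); pose proof (pow2_ge_0 (y1 s)); lra).
      match goal with |- Rabs (2 * (?p * ?l1 - ?q * ?l2 + ?r * ?l3 - ?w * ?l4)) <= _ =>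
        set (c1 := l1) in *; set (c2 := l2) in *; set (c3 := l3) in *; set (c4 := l4) in *;
        set (p' := p) in *; set (q' := q) in *; set (r' := r) in *; set (w' := w) in * end.
      (* [p', q', r', w'] are the four coordinate differences and [c1, c2, c3, c4] the
         differences of the cubic terms that drive them. *)
      assert (T : Rabs (2 * (p' * c1 - q' * c2 + r' * c3 - w' * c4)) <=
              2 * (Rabs p' * Rabs c1 + Rabs q' * Rabs c2 + Rabs r' * Rabs c3 + Rabs w' * Rabs c4)).
      { rewrite <- !Rabs_mult.
        unfold Rabs at 1; destruct Rcase_abs;
        pose proof (Rle_abs (p' * c1)); pose proof (Rle_abs (q' * c2));
        pose proof (Rle_abs (r' * c3)); pose proof (Rle_abs (w' * c4));
        pose proof (Rabs_maj2 (p' * c1)); pose proof (Rabs_maj2 (q' * c2));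
        pose proof (Rabs_maj2 (r' * c3)); pose proof (Rabs_maj2 (w' * c4)); lra. }
      eapply Rle_trans; [exact T | ].
      pose proof (Rabs_pos p') as Pp. pose proof (Rabs_pos q') as Pq.
      pose proof (Rabs_pos r') as Pr. pose proof (Rabs_pos w') as Pw.
      apply (Rmult_le_compat_l _ _ _ Pp) in L1. apply (Rmult_le_compat_l _ _ _ Pq) in L2.
      apply (Rmult_le_compat_l _ _ _ Pr) in L3. apply (Rmult_le_compat_l _ _ _ Pw) in L4.
      assert (Q : (Rabs p' + Rabs q') * (Rabs r' + Rabs w') <=
              Rabs p' ^ 2 + Rabs q' ^ 2 + (Rabs r' ^ 2 + Rabs w' ^ 2)).
      { pose proof (pow2_ge_0 (Rabs p' - Rabs r')). pose proof (pow2_ge_0 (Rabs p' - Rabs w')).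
        pose proof (pow2_ge_0 (Rabs q' - Rabs r')). pose proof (pow2_ge_0 (Rabs q' - Rabs w')).
        lra. }
      apply (Rmult_le_compat_l _ _ _ HM) in Q.
      assert (0 <= M * (Rabs p' ^ 2 + Rabs q' ^ 2 + (Rabs r' ^ 2 + Rabs w' ^ 2))).
      { apply Rmult_le_pos; [exact HM | ].
        pose proof (pow2_ge_0 (Rabs p')). pose proof (pow2_ge_0 (Rabs q')).
        pose proof (pow2_ge_0 (Rabs r')). pose proof (pow2_ge_0 (Rabs w')). lra. }
      lra.
    - unfold E. rewrite I1, I2, I3, I4. ring. }
  unfold E in HE.
  pose proof (pow2_ge_0 (x1 t - u1 t)). pose proof (pow2_ge_0 (y1 t - v1 t)).
  pose proof (pow2_ge_0 (x2 t - u2 t)). pose proof (pow2_ge_0 (y2 t - v2 t)).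
  repeat split; apply Rminus_diag_uniq, Rsqr_eq_0; rewrite Rsqr_pow2; lra.
Qed.

(** * The rotating ansatz *)

Lemma Cexp_i : forall x : R, Cexp (Ci * RtoC x)%C = (cos x, sin x).
Proof.
  intros x. unfold Cexp. simpl.
  replace (0 * x - 1 * 0) with 0 by ring. replace (0 * 0 + 1 * x) with x by ring.
  rewrite exp_0. apply Cmult_1_l.
Qed.

Lemma Cexp_i_plus : forall x y : R,
  Cexp (Ci * RtoC (x + y))%C = (Cexp (Ci * RtoC x) * Cexp (Ci * RtoC y))%C.
Proof.
  intros x y. rewrite !Cexp_i, cos_plus, sin_plus. unfold Cmult. simpl.
  f_equal; ring.
Qed.

(** Multiplying [A1 = r exp (i th)] and [A2 = (p + i q) exp (i th)] by
    [exp (- i th)] leaves [i (r' + i r th') = (p^2 + q^2) (p + i q)] and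
    [i (p' + i q' + i th' (p + i q)) = r^3]; the last four hypotheses are the real
    and imaginary parts.  The equation for the phase is kept in the product form
    [r th'] because [r] may vanish. *)
Lemma rotating_real_system : forall r p q th dr dp dq dth : R -> R,
  (forall t, is_derive r t (dr t)) -> (forall t, is_derive p t (dp t)) ->
  (forall t, is_derive q t (dq t)) -> (forall t, is_derive th t (dth t)) ->
  (forall t, dr t = (p t ^ 2 + q t ^ 2) * q t) ->
  (forall t, r t * dth t = - ((p t ^ 2 + q t ^ 2) * p t)) ->
  (forall t, dp t = q t * dth t) ->
  (forall t, dq t = - r t ^ 3 - p t * dth t) ->
  real_system (fun t => r t * cos (th t)) (fun t => r t * sin (th t))
              (fun t => p t * cos (th t) - q t * sin (th t))
              (fun t => p t * sin (th t) + q t * cos (th t)).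
Proof.
  intros r p q th dr dp dq dth Hr Hp Hq Hth Er Eth Ep Eq t.
  assert (Dr := Hr t). assert (Dp := Hp t). assert (Dq := Hq t). assert (Dth := Hth t).
  assert (Hsc : forall a b, (a * cos (th t) - b * sin (th t)) ^ 2
                     + (a * sin (th t) + b * cos (th t)) ^ 2 = a ^ 2 + b ^ 2).
  { intros a b. pose proof (sin2_cos2 (th t)) as H. unfold Rsqr in H.
    replace (a ^ 2 + b ^ 2) with ((a ^ 2 + b ^ 2) * (sin (th t) * sin (th t) + cos (th t) * cos (th t)))
      by (rewrite H; ring). ring. }
  pose proof (Hsc (r t) 0) as Hn. rewrite !Rmult_0_l, Rminus_0_r, Rplus_0_r in Hn.
  rewrite (Hsc (p t) (q t)), Hn.
  specialize (Er t). specialize (Eth t). specialize (Ep t). specialize (Eq t).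
  assert (Ur := is_derive_unique (fun x : R => r x) t _ Dr).
  assert (Up := is_derive_unique (fun x : R => p x) t _ Dp).
  assert (Uq := is_derive_unique (fun x : R => q x) t _ Dq).
  assert (Uth := is_derive_unique (fun x : R => th x) t _ Dth).
  split; [ | split; [ | split]]; auto_derive;
    try (repeat split; eexists; eassumption);
    rewrite ?Ur, ?Up, ?Uq, ?Uth.
  - replace (r t * _) with (- (r t * dth t * sin (th t))) by ring.
    rewrite Er, Eth. ring.
  - replace (r t * _) with (r t * dth t * cos (th t)) by ring.
    rewrite Er, Eth. ring.
  - rewrite Ep, Eq. ring.
  - rewrite Ep, Eq. ring.
Qed.

Lemma solution_is_rotating : forall (psi1 psi2 : C) (A1 A2 : R -> C)
    (r p q th dr dp dq dth : R -> R),
  (forall t, is_derive r t (dr t)) -> (forall t, is_derive p t (dp t)) ->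
  (forall t, is_derive q t (dq t)) -> (forall t, is_derive th t (dth t)) ->
  (forall t, dr t = (p t ^ 2 + q t ^ 2) * q t) ->
  (forall t, r t * dth t = - ((p t ^ 2 + q t ^ 2) * p t)) ->
  (forall t, dp t = q t * dth t) ->
  (forall t, dq t = - r t ^ 3 - p t * dth t) ->
  psi1 = (RtoC (r 0) * Cexp (Ci * RtoC (th 0)))%C ->
  psi2 = ((RtoC (p 0) + Ci * RtoC (q 0)) * Cexp (Ci * RtoC (th 0)))%C ->
  is_solution psi1 psi2 A1 A2 ->
  forall t, A1 t = (RtoC (r t) * Cexp (Ci * RtoC (th t)))%C /\
            A2 t = ((RtoC (p t) + Ci * RtoC (q t)) * Cexp (Ci * RtoC (th t)))%C.
Proof.
  intros psi1 psi2 A1 A2 r p q th dr dp dq dth Hr Hp Hq Hth Er Eth Ep Eq I1 I2 HA t.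
  pose proof (rotating_real_system _ _ _ _ _ _ _ _ Hr Hp Hq Hth Er Eth Ep Eq) as HB.
  pose proof (real_system_of_solution _ _ _ _ HA) as HS.
  destruct HA as (_ & HA1 & HA2). rewrite <- HA1 in I1. rewrite <- HA2 in I2.
  rewrite Cexp_i in I1, I2 |- *.
  destruct (real_system_unique _ _ _ _ _ _ _ _ HS HB) with (t := t) as (U1 & U2 & U3 & U4).
  - cbv beta. rewrite I1. simpl. ring.
  - cbv beta. rewrite I1. simpl. ring.
  - cbv beta. rewrite I2. simpl. ring.
  - cbv beta. rewrite I2. simpl. ring.
  - cbv beta in U1, U2, U3, U4. unfold Re, Im in U1, U2, U3, U4.
    split; [rewrite (surjective_pairing (A1 t)), U1, U2
           | rewrite (surjective_pairing (A2 t)), U3, U4];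
      unfold Cmult, Cplus; simpl; f_equal; ring.
Qed.

(** * Nonzero overlap *)

(** The product of the two quantities is [dn^2 - m sn^2 = 1 - 2 m sn^2 > 0]
    and their sum is [2 dn > 0]. *)
Lemma dn_dominates_sn : forall m t : R, 0 <= m < 1 / 2 ->
  0 < dn t m + sqrt m * sn t m /\ 0 < dn t m - sqrt m * sn t m.
Proof.
  intros m t Hm.
  pose proof (dn_pos t m ltac:(lra)) as Hp. pose proof (dn_sqr t m ltac:(lra)) as Hd.
  pose proof (pow2_sqrt m ltac:(lra)) as Hs. pose proof (sn2_cn2 t m) as H1.
  pose proof (pow2_ge_0 (cn t m)).
  assert (Hprod : 0 < (dn t m + sqrt m * sn t m) * (dn t m - sqrt m * sn t m)).
  { replace ((dn t m + sqrt m * sn t m) * (dn t m - sqrt m * sn t m))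
      with (dn t m ^ 2 - sqrt m ^ 2 * sn t m ^ 2) by ring.
    rewrite Hd, Hs. nra. }
  split; nra.
Qed.

(** Along the solution this quotient is [|A2|^2 / |A1|^2]; multiplied by
    [- R0 / 2] it is the angular velocity of [A1]. *)
Definition phase_rate (alpha m t0 s : R) : R :=
  (1 - sqrt m * sd (alpha * s + t0) m) / (1 + sqrt m * sd (alpha * s + t0) m).

Lemma phase_rate_eq : forall alpha m t0 s : R, 0 <= m < 1 / 2 ->
  phase_rate alpha m t0 s =
    (dn (alpha * s + t0) m - sqrt m * sn (alpha * s + t0) m)
    / (dn (alpha * s + t0) m + sqrt m * sn (alpha * s + t0) m).
Proof.
  intros alpha m t0 s Hm. unfold phase_rate, sd. set (u := alpha * s + t0).
  pose proof (dn_pos u m ltac:(lra)). pose proof (dn_dominates_sn m u Hm) as [H1 _].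
  field. repeat split; lra.
Qed.

Lemma is_derive_phase : forall alpha m t0 tau : R, 0 <= m < 1 / 2 ->
  is_derive (fun x => RInt (V := R_CompleteNormedModule) (phase_rate alpha m t0) 0 x) tau
            (phase_rate alpha m t0 tau).
Proof.
  intros alpha m t0 tau Hm.
  assert (Hc : forall s, continuous (phase_rate alpha m t0) s).
  { intros s.
    apply (continuous_ext (fun s =>
      (dn (alpha * s + t0) m - sqrt m * sn (alpha * s + t0) m)
      / (dn (alpha * s + t0) m + sqrt m * sn (alpha * s + t0) m))).
    - intros x. symmetry. now apply phase_rate_eq.
    - apply (ex_derive_continuous (fun s =>
      (dn (alpha * s + t0) m - sqrt m * sn (alpha * s + t0) m)
      / (dn (alpha * s + t0) m + sqrt m * sn (alpha * s + t0) m))).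
      pose proof (dn_dominates_sn m (alpha * s + t0) Hm) as [H1 _].
      assert (ex_derive (fun x => dn x m) (alpha * s + t0))
        by (eexists; apply is_derive_dn; lra).
      assert (ex_derive (fun x => sn x m) (alpha * s + t0))
        by (eexists; apply is_derive_sn; lra).
      auto_derive. repeat split; try assumption. lra. }
  apply (is_derive_RInt (phase_rate alpha m t0) _ 0 tau).
  - apply filter_forall. intros y. apply (RInt_correct (V := R_CompleteNormedModule)).
    apply ex_RInt_continuous. auto.
  - apply Hc.
Qed.

(** The scales [k1] and [k2] stand for [2^(-3/4) alpha^(1/2)] and
    [2^(-1/4) alpha^(-1/2)]; the verification uses only their product and the
    value of [k1^4]. *)
Lemma solution_nonzero_overlap :
  forall (psi1 psi2 : C) (A1 A2 : R -> C) (alpha R0 m k1 k2 theta0 t0 : R),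
  0 <= m < 1 / 2 -> alpha ^ 2 * m = alpha ^ 2 / 2 - R0 ^ 2 ->
  0 < k1 -> k1 * k2 = 1 / 2 -> k1 ^ 4 = alpha ^ 2 / 8 ->
  let g := fun t => sqrt (dn t m + sqrt m * sn t m) in
  psi1 = (RtoC (k1 * g t0) * Cexp (Ci * RtoC theta0))%C ->
  psi2 = ((RtoC (k2 * R0 / g t0) + Ci * RtoC (k2 * alpha * sqrt m * cn t0 m / g t0))
          * Cexp (Ci * RtoC theta0))%C ->
  is_solution psi1 psi2 A1 A2 ->
  forall tau,
  let theta := theta0 - R0 / 2
     * RInt (V := R_CompleteNormedModule) (phase_rate alpha m t0) 0 tau in
  let u := alpha * tau + t0 in
  A1 tau = (RtoC (k1 * g u) * Cexp (Ci * RtoC theta))%C /\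
  A2 tau = ((RtoC (k2 * R0 / g u) + Ci * RtoC (k2 * alpha * sqrt m * cn u m / g u))
            * Cexp (Ci * RtoC theta))%C.
Proof.
  intros psi1 psi2 A1 A2 alpha R0 m k1 k2 theta0 t0 Hm Hinv Hk1 Hk Hk4 g I1 I2 HA tau.
  set (sm := sqrt m) in *.
  assert (Hsm : sm ^ 2 = m) by (apply pow2_sqrt; lra).
  pose (H := fun t => dn t m - sm * sn t m).
  assert (HG : forall t, 0 < dn t m + sm * sn t m) by (intros t; now apply dn_dominates_sn).
  assert (Hg : forall t, 0 < g t) by (intros t; apply sqrt_lt_R0, HG).
  assert (Hg2 : forall t, g t ^ 2 = dn t m + sm * sn t m)
    by (intros t; apply pow2_sqrt; specialize (HG t); lra).
  assert (HGH : forall t, g t ^ 2 * H t = 1 - 2 * m * sn t m ^ 2).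
  { intros t. unfold H. rewrite Hg2. pose proof (dn_sqr t m ltac:(lra)) as Hd.
    replace ((dn t m + sm * sn t m) * (dn t m - sm * sn t m))
      with (dn t m ^ 2 - sm ^ 2 * sn t m ^ 2) by ring.
    rewrite Hd, Hsm. ring. }
  assert (Dg : forall t, is_derive g t (sm * cn t m * H t / (2 * g t))).
  { intros t. assert (Ds := is_derive_sn m t ltac:(lra)).
    assert (Dd := is_derive_dn m t ltac:(lra)). specialize (HG t). specialize (Hg t).
    unfold g at 1. auto_derive.
    - split; [eexists; exact Dd | split; [eexists; exact Ds | split; [exact HG | exact I]]].
    - rewrite (is_derive_unique (fun x : R => sn x m) t _ Ds),
        (is_derive_unique (fun x : R => dn x m) t _ Dd).
      fold (g t). unfold H. rewrite <- Hsm at 1. field. lra. }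
  assert (HP : forall t, phase_rate alpha m t0 t
                  = H (alpha * t + t0) / g (alpha * t + t0) ^ 2).
  { intros t. rewrite Hg2. now apply phase_rate_eq. }
  clearbody g.
  assert (Ek2 : k2 = 1 / (2 * k1)).
  { apply (Rmult_eq_reg_l k1); [ | lra]. rewrite Hk. field. lra. }
  (* [|conj A1 * A2|^2 = |A1|^2 |A2|^2], up to scale. *)
  assert (Hsum : forall u, R0 ^ 2 + alpha ^ 2 * sm ^ 2 * cn u m ^ 2
                           = alpha ^ 2 / 2 * (g u ^ 2 * H u)).
  { intros u. rewrite HGH, Hsm. pose proof (sn2_cn2 u m).
    replace (cn u m ^ 2) with (1 - sn u m ^ 2) by lra.
    replace (R0 ^ 2) with (alpha ^ 2 / 2 - alpha ^ 2 * m) by lra. field. }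
  (* The squared modulus of [A2]. *)
  assert (HY : forall u, (k2 * R0 / g u) ^ 2 + (k2 * alpha * sm * cn u m / g u) ^ 2
                         = k1 ^ 2 * H u).
  { intros u. specialize (Hg u).
    replace ((k2 * R0 / g u) ^ 2 + (k2 * alpha * sm * cn u m / g u) ^ 2)
      with (k2 ^ 2 * (R0 ^ 2 + alpha ^ 2 * sm ^ 2 * cn u m ^ 2) / g u ^ 2) by (field; lra).
    rewrite Hsum, Ek2. replace (alpha ^ 2) with (8 * k1 ^ 4) by lra. field. lra. }
  set (th := fun t => theta0 - R0 / 2
     * RInt (V := R_CompleteNormedModule) (phase_rate alpha m t0) 0 t).
  assert (Hth0 : th 0 = theta0).
  { unfold th. rewrite (RInt_point (V := R_CompleteNormedModule)).
    change (theta0 - R0 / 2 * 0 = theta0). ring. }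
  assert (Hu0 : alpha * 0 + t0 = t0) by ring.
  apply (solution_is_rotating psi1 psi2 A1 A2
    (fun t => k1 * g (alpha * t + t0)) (fun t => k2 * R0 / g (alpha * t + t0))
    (fun t => k2 * alpha * sm * cn (alpha * t + t0) m / g (alpha * t + t0)) th
    (fun t => let u := alpha * t + t0 in k1 * alpha * (sm * cn u m * H u / (2 * g u)))
    (fun t => let u := alpha * t + t0 in
              - k2 * R0 * alpha * (sm * cn u m * H u / (2 * g u)) / g u ^ 2)
    (fun t => let u := alpha * t + t0 in
              k2 * alpha ^ 2 * sm * (- (sn u m * dn u m) / g u
                 - cn u m * (sm * cn u m * H u / (2 * g u)) / g u ^ 2))
    (fun t => - (R0 / 2) * phase_rate alpha m t0 t)); try exact HA.
  - intros t. cbv zeta. set (u := alpha * t + t0). assert (D := Dg u).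
    auto_derive; [eexists; exact D | ]. fold u.
    rewrite (is_derive_unique (fun x : R => g x) _ _ D). ring.
  - intros t. cbv zeta. set (u := alpha * t + t0). assert (D := Dg u). assert (P := Hg u).
    auto_derive.
    + fold u. split; [eexists; exact D | split; [lra | exact I]].
    + fold u. rewrite (is_derive_unique (fun x : R => g x) _ _ D). field. lra.
  - intros t. cbv zeta. set (u := alpha * t + t0). assert (D := Dg u). assert (P := Hg u).
    assert (Dc := is_derive_cn m u ltac:(lra)).
    auto_derive.
    + fold u. split; [eexists; exact Dc | split; [eexists; exact D | split; [lra | exact I]]].
    + fold u. rewrite (is_derive_unique (fun x : R => g x) _ _ D),
       (is_derive_unique (fun x : R => cn x m) _ _ Dc). field. lra.
  - intros t. assert (D := is_derive_phase alpha m t0 t Hm). unfold th.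
    revert D. generalize (phase_rate alpha m t0 t).
    generalize (RInt (V := R_CompleteNormedModule) (phase_rate alpha m t0) 0).
    intros F l D. auto_derive; [eexists; exact D | ].
    rewrite (is_derive_unique (fun x : R => F x) _ _ D). ring.
  - intros t. cbv zeta. rewrite HY. set (u := alpha * t + t0). specialize (Hg u).
    rewrite Ek2. field. lra.
  - intros t. rewrite HY, HP. set (u := alpha * t + t0). specialize (Hg u).
    rewrite Ek2. field. lra.
  - intros t. cbv zeta. rewrite HP. set (u := alpha * t + t0). specialize (Hg u).
    field. lra.
  - intros t. cbv zeta. rewrite HP. set (u := alpha * t + t0). specialize (Hg u).
    assert (Hk3 : k1 ^ 3 = k2 * alpha ^ 2 / 4).
    { rewrite Ek2. replace (alpha ^ 2) with (8 * k1 ^ 4) by lra. field. lra. }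
    rewrite Rpow_mult_distr, Hk3.
    (* After the equation for [R0^2 + alpha^2 m cn^2] is used, what is left of
       [q' + p th' = - r^3] is this identity, where [g^2] is [dn + sqrt m sn]. *)
    assert (Hid : 4 * sm * sn u m * dn u m + H u ^ 2 = (g u ^ 2) ^ 2)
      by (rewrite Hg2; unfold H; ring).
    replace (k2 * alpha ^ 2 / 4 * g u ^ 3)
      with (k2 * alpha ^ 2 / (4 * g u) * (g u ^ 2) ^ 2) by (field; lra).
    rewrite <- Hid.
    replace (k2 * alpha ^ 2 / (4 * g u) * (4 * sm * sn u m * dn u m + H u ^ 2))
      with (k2 / (2 * g u ^ 3) * (2 * alpha ^ 2 * sm * sn u m * dn u m * g u ^ 2
              + H u * (alpha ^ 2 / 2 * (g u ^ 2 * H u)))) by (field; lra).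
    rewrite <- Hsum. field. lra.
  - cbv beta. now rewrite Hu0, Hth0.
  - cbv beta. now rewrite Hu0, Hth0.
Qed.

(** With [X = |psi1|^2], [Y = |psi2|^2] and [I0 = 2 Im (conj psi1 * psi2)], the
    formulas force [sqrt m sn t0 = (X - Y) / (2 k1^2)] and
    [sqrt m cn t0 = I0 / alpha].  The squares of these two numbers add up to [m]
    because [R0^2 + I0^2 = 4 X Y], so such an amplitude exists.  Then
    [dn t0 = (X + Y) / (2 k1^2)], which gives [|A1 (0)|^2 = X], and [theta0] is
    the argument of [psi1], which is nonzero since [R0 <> 0]. *)
Lemma nonzero_overlap_initial : forall (psi1 psi2 : C) (alpha R0 m k1 k2 : R),
  0 < alpha -> alpha ^ 2 = 4 * (Cmod psi1 ^ 4 + Cmod psi2 ^ 4) ->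
  R0 = 2 * Re (Cconj psi1 * psi2)%C -> R0 <> 0 ->
  0 <= m < 1 / 2 -> alpha ^ 2 * m = alpha ^ 2 / 2 - R0 ^ 2 ->
  0 < k1 -> k1 * k2 = 1 / 2 -> k1 ^ 4 = alpha ^ 2 / 8 ->
  let g := fun t => sqrt (dn t m + sqrt m * sn t m) in
  exists theta0 t0 : R,
  psi1 = (RtoC (k1 * g t0) * Cexp (Ci * RtoC theta0))%C /\
  psi2 = ((RtoC (k2 * R0 / g t0) + Ci * RtoC (k2 * alpha * sqrt m * cn t0 m / g t0))
          * Cexp (Ci * RtoC theta0))%C.
Proof.
  intros [a b] [c d] alpha R0 m k1 k2 Ha Halpha HR HR0 Hm Hinv Hk1 Hk Hk4 g.
  rewrite !Cmod_pow4 in Halpha. simpl Re in *. simpl Im in *.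
  set (X := a ^ 2 + b ^ 2) in *. set (Y := c ^ 2 + d ^ 2) in *.
  pose (I0 := 2 * (a * d - b * c)).
  assert (HX : 0 < X).
  { destruct (Rle_lt_dec X 0) as [h | h]; [exfalso | exact h].
    unfold X in h. pose proof (pow2_ge_0 a). pose proof (pow2_ge_0 b).
    assert (a = 0) by (apply Rsqr_eq_0; rewrite Rsqr_pow2; lra).
    assert (b = 0) by (apply Rsqr_eq_0; rewrite Rsqr_pow2; lra).
    subst a b. apply HR0. rewrite HR. ring. }
  assert (HY : 0 <= Y) by (unfold Y; pose proof (pow2_ge_0 c); pose proof (pow2_ge_0 d); lra).
  assert (HRI : R0 ^ 2 + I0 ^ 2 = 4 * (X * Y)) by (rewrite HR; unfold I0, X, Y; ring).
  destruct (polar_coordinates (sqrt X) b a) as (theta0 & Hb & Hacos).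
  { apply sqrt_pos. }
  { rewrite pow2_sqrt by lra. unfold X. ring. }
  assert (Hk14 : (2 * k1 ^ 2) ^ 2 = 2 * (X ^ 2 + Y ^ 2)).
  { replace ((2 * k1 ^ 2) ^ 2) with (4 * k1 ^ 4) by ring. rewrite Hk4, Halpha. field. }
  assert (HXY : 0 < X ^ 2 + Y ^ 2) by nra.
  destruct (polar_coordinates (sqrt m) ((X - Y) / (2 * k1 ^ 2)) (I0 / alpha))
    as (phi & Hs & Hc).
  { apply sqrt_pos. }
  { rewrite pow2_sqrt by lra.
    unfold Rdiv. rewrite !Rpow_mult_distr, !pow_inv, Hk14, Halpha.
    replace (I0 ^ 2) with (4 * (X * Y) - R0 ^ 2) by lra.
    replace (R0 ^ 2) with (alpha ^ 2 * (1 / 2 - m)) by lra. rewrite Halpha.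
    field. lra. }
  exists theta0, (ellipticF phi m).
  assert (Hsn : sqrt m * sn (ellipticF phi m) m = (X - Y) / (2 * k1 ^ 2)).
  { unfold sn. rewrite jacobi_am_ellipticF by lra. exact Hs. }
  assert (Hcn : sqrt m * cn (ellipticF phi m) m = I0 / alpha).
  { unfold cn. rewrite jacobi_am_ellipticF by lra. exact Hc. }
  assert (Hdn : dn (ellipticF phi m) m = (X + Y) / (2 * k1 ^ 2)).
  { pose proof (dn_pos (ellipticF phi m) m ltac:(lra)).
    pose proof (dn_sqr (ellipticF phi m) m ltac:(lra)) as Hd.
    apply Rsqr_inj; [lra | apply Rlt_le, Rdiv_lt_0_compat; nra | ].
    rewrite !Rsqr_pow2, Hd. rewrite <- (pow2_sqrt m) at 1 by lra.
    rewrite <- Rpow_mult_distr, Hsn.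
    unfold Rdiv. rewrite !Rpow_mult_distr, !pow_inv, Hk14. field. lra. }
  assert (Hg : k1 * g (ellipticF phi m) = sqrt X).
  { unfold g. rewrite Hsn, Hdn.
    replace ((X + Y) / (2 * k1 ^ 2) + (X - Y) / (2 * k1 ^ 2)) with (X / k1 ^ 2)
      by (field; lra).
    rewrite sqrt_div_alt, sqrt_pow2 by (try lra; apply pow_lt, Hk1). field. lra. }
  assert (HsX : 0 < sqrt X) by (apply sqrt_lt_R0, HX).
  assert (HgX : g (ellipticF phi m) = sqrt X / k1) by (rewrite <- Hg; field; lra).
  assert (Ek2 : k2 = 1 / (2 * k1)).
  { apply (Rmult_eq_reg_l k1); [ | lra]. rewrite Hk. field. lra. }
  replace (k2 * alpha * sqrt m * cn (ellipticF phi m) m)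
    with (k2 * alpha * (sqrt m * cn (ellipticF phi m) m)) by ring.
  rewrite Hcn, Hg, HgX, Ek2, Cexp_i. unfold Cmult, Cplus; simpl.
  assert (HX2 : X = sqrt X * sqrt X) by (symmetry; apply sqrt_sqrt; lra).
  split; f_equal.
  - lra.
  - lra.
  - transitivity ((R0 * (sqrt X * cos theta0) - I0 * (sqrt X * sin theta0))
                  / (2 * (sqrt X * sqrt X))).
    + rewrite Hb, Hacos, <- HX2, HR. unfold I0, X. field. fold X. lra.
    + field. lra.
  - transitivity ((R0 * (sqrt X * sin theta0) + I0 * (sqrt X * cos theta0))
                  / (2 * (sqrt X * sqrt X))).
    + rewrite Hb, Hacos, <- HX2, HR. unfold I0, X. field. fold X. lra.
    + field. lra.
Qed.

(** * The duplication formula for dn *)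

(** Uniqueness for the differential system of [sn, cn, dn], run at speed [k].
    In the derivative of the squared distance, differences of products such as
    [c1 d1 - c2 d2] are split so that the factor outside each product of two
    differences is a bounded one, [s] or [c]; the terms in [d2] cancel. *)
Lemma jacobi_system_unique : forall (m k : R) (s1 c1 d1 s2 c2 d2 : R -> R),
  0 <= m <= 1 ->
  (forall t, is_derive s1 t (k * (c1 t * d1 t))) ->
  (forall t, is_derive c1 t (- k * (s1 t * d1 t))) ->
  (forall t, is_derive d1 t (- k * (m * (s1 t * c1 t)))) ->
  (forall t, is_derive s2 t (k * (c2 t * d2 t))) ->
  (forall t, is_derive c2 t (- k * (s2 t * d2 t))) ->
  (forall t, is_derive d2 t (- k * (m * (s2 t * c2 t)))) ->
  (forall t, s1 t ^ 2 + c1 t ^ 2 = 1) -> (forall t, s2 t ^ 2 + c2 t ^ 2 = 1) ->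
  s1 0 = s2 0 -> c1 0 = c2 0 -> d1 0 = d2 0 ->
  forall t, s1 t = s2 t /\ c1 t = c2 t /\ d1 t = d2 t.
Proof.
  intros m k s1 c1 d1 s2 c2 d2 Hm S1 C1 D1 S2 C2 D2 N1 N2 Is Ic Id t.
  pose (E := fun t => (s1 t - s2 t) ^ 2 + (c1 t - c2 t) ^ 2 + (d1 t - d2 t) ^ 2).
  pose (e := fun t => (s1 t - s2 t) * (d1 t - d2 t) * (c1 t - m * c2 t)
                      - (c1 t - c2 t) * (d1 t - d2 t) * ((1 + m) * s1 t)).
  assert (HE : E t = 0).
  { apply (gronwall_zero E (fun t => 2 * k * e t) (4 * Rabs k)).
    - intros u. specialize (S1 u). specialize (C1 u). specialize (D1 u).
      specialize (S2 u). specialize (C2 u). specialize (D2 u).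
      unfold E, e. auto_derive.
      + repeat split; eexists; eassumption.
      + rewrite (is_derive_unique (fun x : R => s1 x) u _ S1),
          (is_derive_unique (fun x : R => c1 x) u _ C1),
          (is_derive_unique (fun x : R => d1 x) u _ D1),
          (is_derive_unique (fun x : R => s2 x) u _ S2),
          (is_derive_unique (fun x : R => c2 x) u _ C2),
          (is_derive_unique (fun x : R => d2 x) u _ D2). ring.
    - intros u. unfold E. pose proof (pow2_ge_0 (s1 u - s2 u)).
      pose proof (pow2_ge_0 (c1 u - c2 u)). pose proof (pow2_ge_0 (d1 u - d2 u)). lra.
    - intros u. rewrite !Rabs_mult, (Rabs_pos_eq 2) by lra.
      assert (He : Rabs (e u) <= 2 * E u).
      { unfold e, E. specialize (N1 u). specialize (N2 u).
        set (x := s1 u - s2 u). set (y := c1 u - c2 u). set (z := d1 u - d2 u).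
        assert (B : forall v w, v ^ 2 + w ^ 2 = 1 -> -1 <= v <= 1).
        { intros v w Hvw. pose proof (pow2_ge_0 w). split; nra. }
        pose proof (B _ _ N1). rewrite Rplus_comm in N1, N2.
        pose proof (B _ _ N1). pose proof (B _ _ N2).
        assert (Hc : -2 <= c1 u - m * c2 u <= 2) by (split; nra).
        assert (Hs : -2 <= (1 + m) * s1 u <= 2) by (split; nra).
        assert (Hxz : forall v w b, -2 <= b <= 2 -> - (v ^ 2 + w ^ 2) <= v * w * b <= v ^ 2 + w ^ 2).
        { intros v w b Hb. pose proof (pow2_ge_0 (v - w)). pose proof (pow2_ge_0 (v + w)).
          split; nra. }
        pose proof (Hxz x z _ Hc). pose proof (Hxz y z _ Hs).
        pose proof (pow2_ge_0 x). pose proof (pow2_ge_0 y).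
        apply Rabs_le. split; lra. }
      pose proof (Rabs_pos k). nra.
    - unfold E. rewrite Is, Ic, Id. ring. }
  unfold E in HE. pose proof (pow2_ge_0 (s1 t - s2 t)).
  pose proof (pow2_ge_0 (c1 t - c2 t)). pose proof (pow2_ge_0 (d1 t - d2 t)).
  repeat split; apply Rminus_diag_uniq, Rsqr_eq_0; rewrite Rsqr_pow2; lra.
Qed.

Lemma jacobi_am_0 : forall m : R, 0 <= m < 1 -> jacobi_am 0 m = 0.
Proof.
  intros m Hm. rewrite <- (jacobi_am_ellipticF m 0 Hm) at 2. f_equal.
  symmetry. apply (RInt_point (V := R_CompleteNormedModule)).
Qed.

(** The duplication formulas give a triple that solves the differential system
    of [sn, cn, dn] at double speed with the same initial values as
    [sn (2 t), cn (2 t), dn (2 t)]; this is the third component. *)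
Lemma dn_double : forall m t : R, 0 <= m < 1 ->
  dn (2 * t) m * (1 - m * sn t m ^ 4) = dn t m ^ 2 - m * sn t m ^ 2 * cn t m ^ 2.
Proof.
  intros m t Hm.
  pose (s := fun t => sn t m). pose (c := fun t => cn t m). pose (d := fun t => dn t m).
  assert (Ds : forall t, is_derive s t (c t * d t)) by (intros; now apply is_derive_sn).
  assert (Dc : forall t, is_derive c t (- (s t * d t))) by (intros; now apply is_derive_cn).
  assert (Dd : forall t, is_derive d t (- (m * (s t * c t)))) by (intros; now apply is_derive_dn).
  assert (Hc : forall t, c t ^ 2 = 1 - s t ^ 2).
  { intros u. pose proof (sn2_cn2 u m). unfold c, s. lra. }
  assert (Hd : forall t, d t ^ 2 = 1 - m * s t ^ 2) by (intros u; now apply dn_sqr).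
  pose (D := fun t => 1 - m * s t ^ 4).
  assert (HD : forall t, D t <> 0).
  { intros u. unfold D. specialize (Hc u). pose proof (pow2_ge_0 (c u)).
    pose proof (pow2_ge_0 (s u)).
    replace (s u ^ 4) with (s u ^ 2 * s u ^ 2) by ring. apply Rgt_not_eq.
    assert (s u ^ 2 * s u ^ 2 <= 1) by nra. nra. }
  assert (H0 : s 0 = 0 /\ c 0 = 1 /\ d 0 = 1).
  { unfold s, c, d, dn, sn, cn. rewrite jacobi_am_0, sin_0, cos_0 by assumption.
    repeat split. replace (1 - m * 0 ^ 2) with 1 by ring. apply sqrt_1. }
  destruct H0 as (Hs0 & Hc0 & Hd0).
  destruct (jacobi_system_unique m 2 (fun t => s (2 * t)) (fun t => c (2 * t)) (fun t => d (2 * t))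
    (fun t => 2 * s t * c t * d t / D t)
    (fun t => (c t ^ 2 - s t ^ 2 * d t ^ 2) / D t)
    (fun t => (d t ^ 2 - m * s t ^ 2 * c t ^ 2) / D t)) with (t := t) as (_ & _ & H).
  - lra.
  - intros u. specialize (Ds (2 * u)). auto_derive; [eexists; exact Ds | ].
    rewrite (is_derive_unique (fun x : R => s x) _ _ Ds). ring.
  - intros u. specialize (Dc (2 * u)). auto_derive; [eexists; exact Dc | ].
    rewrite (is_derive_unique (fun x : R => c x) _ _ Dc). ring.
  - intros u. specialize (Dd (2 * u)). auto_derive; [eexists; exact Dd | ].
    rewrite (is_derive_unique (fun x : R => d x) _ _ Dd). ring.
  - intros u. specialize (Ds u). specialize (Dc u). specialize (Dd u). specialize (HD u).
    specialize (Hc u). specialize (Hd u). unfold D in *. auto_derive.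
    + repeat split; try (eexists; eassumption). exact HD.
    + rewrite (is_derive_unique (fun x : R => s x) _ _ Ds),
        (is_derive_unique (fun x : R => c x) _ _ Dc),
        (is_derive_unique (fun x : R => d x) _ _ Dd).
      field [Hc Hd]. exact HD.
  - intros u. specialize (Ds u). specialize (Dc u). specialize (Dd u). specialize (HD u).
    specialize (Hc u). specialize (Hd u). unfold D in *. auto_derive.
    + repeat split; try (eexists; eassumption). exact HD.
    + rewrite (is_derive_unique (fun x : R => s x) _ _ Ds),
        (is_derive_unique (fun x : R => c x) _ _ Dc),
        (is_derive_unique (fun x : R => d x) _ _ Dd).
      field [Hc Hd]. exact HD.
  - intros u. specialize (Ds u). specialize (Dc u). specialize (Dd u). specialize (HD u).
    specialize (Hc u). specialize (Hd u). unfold D in *. auto_derive.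
    + repeat split; try (eexists; eassumption). exact HD.
    + rewrite (is_derive_unique (fun x : R => s x) _ _ Ds),
        (is_derive_unique (fun x : R => c x) _ _ Dc),
        (is_derive_unique (fun x : R => d x) _ _ Dd).
      field [Hc Hd]. exact HD.
  - intros u. pose proof (sn2_cn2 (2 * u) m) as H. exact H.
  - intros u. specialize (HD u). specialize (Hc u). specialize (Hd u). unfold D in *.
    field [Hc Hd]. exact HD.
  - unfold D. rewrite Rmult_0_r, Hs0, Hc0, Hd0. field.
  - unfold D. rewrite Rmult_0_r, Hs0, Hc0, Hd0. field.
  - unfold D. rewrite Rmult_0_r, Hs0, Hc0, Hd0. field.
  - cbv beta in H. unfold D, s, c, d in H. rewrite H. field. apply HD.
Qed.

(** * Zero overlap *)

(** At [m = 1/2] the duplication formula reads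
    [dn (2 t) = (1 - sn^2 + sn^4 / 2) / (1 - sn^4 / 2)], so
    [1 + nd (2 t) = 2 dn^2 / (1 - sn^2 + sn^4 / 2)]. *)
Lemma sqrt_one_plus_nd_double : forall t : R,
  sqrt (1 + nd (2 * t) (1 / 2))
  = sqrt 2 * dn t (1 / 2) / sqrt (1 - sn t (1 / 2) ^ 2 + sn t (1 / 2) ^ 4 / 2).
Proof.
  intros t. set (s := sn t (1 / 2)).
  pose proof (dn_pos t (1 / 2) ltac:(lra)) as Hp.
  pose proof (dn_sqr t (1 / 2) ltac:(lra)) as Hd. fold s in Hd.
  pose proof (sn2_cn2 t (1 / 2)) as Hc. fold s in Hc.
  pose proof (dn_pos (2 * t) (1 / 2) ltac:(lra)) as Hp2.
  pose proof (dn_double (1 / 2) t ltac:(lra)) as H. fold s in H.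
  assert (HD : 0 < 1 - s ^ 2 + s ^ 4 / 2).
  { replace (1 - s ^ 2 + s ^ 4 / 2) with (((1 - s ^ 2) ^ 2 + 1) / 2) by field.
    pose proof (pow2_ge_0 (1 - s ^ 2)). lra. }
  assert (HD' : 0 < 1 - 1 / 2 * s ^ 4).
  { pose proof (pow2_ge_0 (cn t (1 / 2))). pose proof (pow2_ge_0 s).
    replace (s ^ 4) with (s ^ 2 * s ^ 2) by ring. nra. }
  replace (cn t (1 / 2) ^ 2) with (1 - s ^ 2) in H by lra. rewrite Hd in H.
  replace (1 - 1 / 2 * s ^ 2 - 1 / 2 * s ^ 2 * (1 - s ^ 2))
    with (1 - s ^ 2 + s ^ 4 / 2) in H by field.
  apply sqrt_lem_1.
  - unfold nd. apply Rlt_le, Rplus_lt_0_compat; [lra | apply Rdiv_lt_0_compat; lra].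
  - apply Rlt_le, Rdiv_lt_0_compat; [ | apply sqrt_lt_R0, HD].
    apply Rmult_lt_0_compat; [apply sqrt_lt_R0; lra | exact Hp].
  - replace (sqrt 2 * dn t (1 / 2) / sqrt (1 - s ^ 2 + s ^ 4 / 2) *
             (sqrt 2 * dn t (1 / 2) / sqrt (1 - s ^ 2 + s ^ 4 / 2)))
      with ((sqrt 2 * sqrt 2) * dn t (1 / 2) ^ 2
            / (sqrt (1 - s ^ 2 + s ^ 4 / 2) * sqrt (1 - s ^ 2 + s ^ 4 / 2)))
      by (field; apply Rgt_not_eq, sqrt_lt_R0, HD).
    rewrite !sqrt_sqrt, Hd by lra.
    replace (nd (2 * t) (1 / 2)) with ((1 - 1 / 2 * s ^ 4) / (1 - s ^ 2 + s ^ 4 / 2)).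
    + field. lra.
    + rewrite <- H. unfold nd. field. lra.
Qed.

(** Here [r' = k cn^3 / D^3] and [q' = - k sn^3 dn^3 / D^3] as functions of the
    Jacobi variable, that is [k^2 r' = q^3] and [k^2 q' = - r^3].  The Jacobi
    variable moves at speed [alpha / 2 = k^2]. *)
Lemma solution_zero_overlap :
  forall (psi1 psi2 : C) (A1 A2 : R -> C) (alpha k theta0 t0 : R),
  k ^ 2 = alpha / 2 ->
  let D := fun v => sqrt (1 - sn v (1 / 2) ^ 2 + sn v (1 / 2) ^ 4 / 2) in
  let r := fun v => k * sn v (1 / 2) * dn v (1 / 2) / D v in
  let q := fun v => k * cn v (1 / 2) / D v in
  psi1 = (RtoC (r (1 / 2 * t0)%R) * Cexp (Ci * RtoC theta0))%C ->
  psi2 = (Ci * RtoC (q (1 / 2 * t0)%R) * Cexp (Ci * RtoC theta0))%C ->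
  is_solution psi1 psi2 A1 A2 ->
  forall tau, let v := 1 / 2 * (alpha * tau + t0) in
  A1 tau = (RtoC (r v) * Cexp (Ci * RtoC theta0))%C /\
  A2 tau = (Ci * RtoC (q v) * Cexp (Ci * RtoC theta0))%C.
Proof.
  intros psi1 psi2 A1 A2 alpha k theta0 t0 Hk D r q I1 I2 HA.
  pose (m := 1 / 2). assert (Hm : 0 <= m < 1) by (unfold m; lra).
  assert (HD : forall v, 0 < 1 - sn v m ^ 2 + sn v m ^ 4 / 2).
  { intros v. replace (1 - sn v m ^ 2 + sn v m ^ 4 / 2)
      with (((1 - sn v m ^ 2) ^ 2 + 1) / 2) by field.
    pose proof (pow2_ge_0 (1 - sn v m ^ 2)). lra. }
  assert (HDp : forall v, 0 < D v) by (intros v; apply sqrt_lt_R0, HD).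
  assert (HD2 : forall v, D v ^ 2 = 1 - sn v m ^ 2 + sn v m ^ 4 / 2)
    by (intros v; apply pow2_sqrt, Rlt_le, HD).
  assert (Hc : forall v, cn v m ^ 2 = 1 - sn v m ^ 2)
    by (intros v; pose proof (sn2_cn2 v m); lra).
  assert (Hd : forall v, dn v m ^ 2 = 1 - m * sn v m ^ 2) by (intros v; now apply dn_sqr).
  assert (DD : forall v, is_derive D v (- (sn v m * cn v m ^ 3 * dn v m) / D v)).
  { intros v. assert (Ds := is_derive_sn m v Hm). specialize (HD v). specialize (HDp v).
    specialize (Hc v).
    unfold D at 1. fold m. auto_derive.
    - repeat split; try (eexists; exact Ds).
      match goal with |- 0 < ?e =>
        replace e with (1 - sn v m ^ 2 + sn v m ^ 4 / 2) by field end. exact HD.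
    - rewrite (is_derive_unique (fun x : R => sn x m) _ _ Ds).
      match goal with |- context [sqrt ?e] =>
        replace (sqrt e) with (D v) by (unfold D; fold m; f_equal; field) end.
      field [Hc]. lra. }
  assert (Dr : forall v, is_derive r v (k * cn v m ^ 3 / D v ^ 3)).
  { intros v. assert (Ds := is_derive_sn m v Hm). assert (Dd := is_derive_dn m v Hm).
    assert (DDv := DD v). specialize (HDp v). specialize (Hc v). specialize (Hd v).
    specialize (HD2 v). clearbody D. unfold r. fold m. auto_derive.
    - repeat split; try (eexists; eassumption). lra.
    - rewrite (is_derive_unique (fun x : R => sn x m) _ _ Ds),
        (is_derive_unique (fun x : R => dn x m) _ _ Dd),
        (is_derive_unique (fun x : R => D x) _ _ DDv).
      assert (HD4 : D v ^ 4 = (1 - sn v m ^ 2 + sn v m ^ 4 / 2) ^ 2)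
        by (rewrite <- HD2; ring).
      unfold m in *. field_simplify_eq [Hc Hd HD2 HD4]; [ | lra]. field. }
  assert (Dq : forall v, is_derive q v (- k * sn v m ^ 3 * dn v m ^ 3 / D v ^ 3)).
  { intros v. assert (Dc := is_derive_cn m v Hm).
    assert (DDv := DD v). specialize (HDp v). specialize (Hc v). specialize (Hd v).
    specialize (HD2 v). clearbody D. unfold q. fold m. auto_derive.
    - repeat split; try (eexists; eassumption). lra.
    - rewrite (is_derive_unique (fun x : R => cn x m) _ _ Dc),
        (is_derive_unique (fun x : R => D x) _ _ DDv).
      unfold m in *. field_simplify_eq [Hc Hd HD2]; [ | lra]. field. }
  fold m in r, q.
  assert (Hv0 : 1 / 2 * (alpha * 0 + t0) = 1 / 2 * t0) by ring.
  intros tau v.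
  destruct (solution_is_rotating psi1 psi2 A1 A2
    (fun t => r (1 / 2 * (alpha * t + t0))) (fun t => 0)
    (fun t => q (1 / 2 * (alpha * t + t0))) (fun t => theta0)
    (fun t => let v := 1 / 2 * (alpha * t + t0) in alpha / 2 * (k * cn v m ^ 3 / D v ^ 3))
    (fun t => 0)
    (fun t => let v := 1 / 2 * (alpha * t + t0) in
              alpha / 2 * (- k * sn v m ^ 3 * dn v m ^ 3 / D v ^ 3))
    (fun t => 0)) with (t := tau) as [B1 B2]; try exact HA.
  - intros t. assert (H := Dr (1 / 2 * (alpha * t + t0))). clearbody r. cbv zeta.
    auto_derive; [eexists; exact H | ].
    rewrite (is_derive_unique (fun x : R => r x) _ _ H). field.
    apply Rgt_not_eq, HDp.
  - intros t. apply (is_derive_const (V := R_NormedModule)).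
  - intros t. assert (H := Dq (1 / 2 * (alpha * t + t0))). clearbody q. cbv zeta.
    auto_derive; [eexists; exact H | ].
    rewrite (is_derive_unique (fun x : R => q x) _ _ H). field.
    apply Rgt_not_eq, HDp.
  - intros t. apply (is_derive_const (V := R_NormedModule)).
  - intros t. cbv zeta. set (w := 1 / 2 * (alpha * t + t0)). specialize (HDp w).
    rewrite <- Hk. unfold q. fold m. field. lra.
  - intros t. ring.
  - intros t. ring.
  - intros t. cbv zeta. set (w := 1 / 2 * (alpha * t + t0)). specialize (HDp w).
    rewrite <- Hk. unfold r. fold m. field. lra.
  - cbv beta. now rewrite Hv0.
  - cbv beta. rewrite Hv0, I2. f_equal. unfold Cplus, Cmult; simpl. f_equal; ring.
  - fold v in B1, B2. split; [exact B1 | rewrite B2].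
    f_equal. unfold Cplus, Cmult; simpl. f_equal; ring.
Qed.

(** The hypothesis says that [psi1] and [psi2] are orthogonal vectors of the
    plane, so [psi2] is a real multiple of [i exp (i theta)] when [psi1] is one
    of [exp (i theta)].  If [psi1 = 0] the angle is read off [psi2] instead. *)
Lemma quadrature_coordinates : forall psi1 psi2 : C, Re (Cconj psi1 * psi2)%C = 0 ->
  exists p q theta : R,
    psi1 = (RtoC p * Cexp (Ci * RtoC theta))%C /\
    psi2 = (Ci * RtoC q * Cexp (Ci * RtoC theta))%C.
Proof.
  intros [a b] [c d] H. simpl in H.
  destruct (Req_dec (a ^ 2 + b ^ 2) 0) as [H0 | H0].
  - pose proof (pow2_ge_0 a). pose proof (pow2_ge_0 b).
    assert (a = 0) by (apply Rsqr_eq_0; rewrite Rsqr_pow2; lra).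
    assert (b = 0) by (apply Rsqr_eq_0; rewrite Rsqr_pow2; lra).
    subst a b.
    pose proof (pow2_ge_0 c). pose proof (pow2_ge_0 d).
    destruct (polar_coordinates (sqrt (c ^ 2 + d ^ 2)) (- c) d) as (theta & Hs & Hc).
    { apply sqrt_pos. }
    { rewrite pow2_sqrt by lra. ring. }
    exists 0, (sqrt (c ^ 2 + d ^ 2)), theta.
    set (rho := sqrt (c ^ 2 + d ^ 2)) in *.
    rewrite Cexp_i. unfold Cmult; simpl. split; f_equal; lra.
  - pose proof (pow2_ge_0 a). pose proof (pow2_ge_0 b).
    set (X := a ^ 2 + b ^ 2) in *.
    assert (HX : 0 < X) by (unfold X in *; lra).
    assert (HsX : 0 < sqrt X) by (apply sqrt_lt_R0, HX).
    assert (HX2 : X = sqrt X * sqrt X) by (symmetry; apply sqrt_sqrt; lra).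
    destruct (polar_coordinates (sqrt X) b a) as (theta & Hs & Hc).
    { lra. }
    { rewrite pow2_sqrt by lra. unfold X. ring. }
    exists (sqrt X), ((a * d - b * c) / sqrt X), theta.
    rewrite Cexp_i. unfold Cmult; simpl. split; f_equal.
    + lra.
    + lra.
    + transitivity (- (a * d - b * c) * (sqrt X * sin theta) / (sqrt X * sqrt X)).
      * rewrite Hs, <- HX2. replace (- (a * d - b * c) * b / X)
          with ((X * c - a * (a * c - - b * d)) / X) by (unfold X; field; exact H0).
        rewrite H. field. lra.
      * field. lra.
    + transitivity ((a * d - b * c) * (sqrt X * cos theta) / (sqrt X * sqrt X)).
      * rewrite Hc, <- HX2. replace ((a * d - b * c) * a / X)
          with ((X * d - b * (a * c - - b * d)) / X) by (unfold X; field; exact H0).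
        rewrite H. field. lra.
      * field. lra.
Qed.

(** Solving [Q = cos / D] for the amplitude gives [cos = Q / sqrt (1 + P^2)], and
    then [D = 1 / sqrt (1 + P^2)].  With [W = 1 + P^2 + Q^2] the equation of the
    curve is equivalent to [W^2 = 2 (1 + P^2) (1 + Q^2)], and it turns [P = sin dn / D]
    into [sin = P sqrt (2 / W)]. *)
Lemma quartic_curve_parametrization : forall P Q : R, P ^ 4 + Q ^ 4 = 1 ->
  exists v : R,
  let D := sqrt (1 - sn v (1 / 2) ^ 2 + sn v (1 / 2) ^ 4 / 2) in
  P = sn v (1 / 2) * dn v (1 / 2) / D /\ Q = cn v (1 / 2) / D.
Proof.
  intros P Q H. pose proof (pow2_ge_0 P) as HP. pose proof (pow2_ge_0 Q) as HQ.
  set (W := 1 + P ^ 2 + Q ^ 2).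
  assert (HW : 0 < W) by (unfold W; lra).
  assert (HW2 : W ^ 2 = 2 * (1 + P ^ 2) * (1 + Q ^ 2)).
  { unfold W. replace ((1 + P ^ 2 + Q ^ 2) ^ 2) with
      (1 + (P ^ 4 + Q ^ 4) + 2 * P ^ 2 + 2 * Q ^ 2 + 2 * P ^ 2 * Q ^ 2) by ring.
    rewrite H. ring. }
  assert (Hsp : 0 < sqrt (1 + P ^ 2)) by (apply sqrt_lt_R0; lra).
  assert (Hsp2 : sqrt (1 + P ^ 2) ^ 2 = 1 + P ^ 2) by (apply pow2_sqrt; lra).
  assert (HsW : sqrt (2 / W) ^ 2 = 2 / W)
    by (apply pow2_sqrt, Rlt_le, Rdiv_lt_0_compat; lra).
  assert (HsWp : 0 < sqrt (2 / W)) by (apply sqrt_lt_R0, Rdiv_lt_0_compat; lra).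
  assert (Hc2 : (Q / sqrt (1 + P ^ 2)) ^ 2 = Q ^ 2 / (1 + P ^ 2)).
  { rewrite <- Hsp2 at 2. field. lra. }
  assert (Hs2 : (P * sqrt (2 / W)) ^ 2 = 1 - Q ^ 2 / (1 + P ^ 2)).
  { rewrite Rpow_mult_distr, HsW.
    apply (Rmult_eq_reg_r (W * (1 + P ^ 2))); [ | apply Rgt_not_eq; nra].
    transitivity (2 * P ^ 2 * (1 + P ^ 2)); [field; lra | ].
    transitivity (W * (1 + P ^ 2 - Q ^ 2)); [ | field; lra].
    replace (W * (1 + P ^ 2 - Q ^ 2)) with (1 + 2 * P ^ 2 + 2 * P ^ 4 - (P ^ 4 + Q ^ 4))
      by (unfold W; ring). rewrite H. ring. }
  destruct (exists_angle (P * sqrt (2 / W)) (Q / sqrt (1 + P ^ 2))) as (phi & Hs & Hc).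
  { rewrite Hc2, Hs2. ring. }
  exists (ellipticF phi (1 / 2)).
  unfold dn. unfold sn, cn. rewrite jacobi_am_ellipticF by lra. rewrite Hs, Hc. cbv zeta.
  assert (HD : sqrt (1 - (P * sqrt (2 / W)) ^ 2 + (P * sqrt (2 / W)) ^ 4 / 2)
               = / sqrt (1 + P ^ 2)).
  { rewrite <- sqrt_inv. f_equal.
    replace ((P * sqrt (2 / W)) ^ 4) with (((P * sqrt (2 / W)) ^ 2) ^ 2) by ring.
    rewrite Hs2.
    replace (1 - (1 - Q ^ 2 / (1 + P ^ 2)) + (1 - Q ^ 2 / (1 + P ^ 2)) ^ 2 / 2)
      with (((1 + P ^ 2) ^ 2 + (P ^ 4 + Q ^ 4) - P ^ 4) / (2 * (1 + P ^ 2) ^ 2))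
      by (field; lra).
    rewrite H. field. lra. }
  rewrite HD. split; [ | field; lra].
  assert (Hdn : sqrt (1 - 1 / 2 * (P * sqrt (2 / W)) ^ 2)
                = / (sqrt (2 / W) * sqrt (1 + P ^ 2))).
  { rewrite <- sqrt_mult_alt by (apply Rlt_le, Rdiv_lt_0_compat; lra).
    rewrite <- sqrt_inv. f_equal. rewrite Hs2. unfold W. field.
    repeat split; lra. }
  rewrite Hdn. field. lra.
Qed.

Lemma zero_overlap_initial : forall (psi1 psi2 : C) (alpha k : R),
  0 < alpha -> alpha ^ 2 = 4 * (Cmod psi1 ^ 4 + Cmod psi2 ^ 4) ->
  Re (Cconj psi1 * psi2)%C = 0 -> k ^ 2 = alpha / 2 ->
  let D := fun v => sqrt (1 - sn v (1 / 2) ^ 2 + sn v (1 / 2) ^ 4 / 2) in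
  exists theta0 t0 : R,
  let v := 1 / 2 * t0 in
  psi1 = (RtoC (k * sn v (1 / 2) * dn v (1 / 2) / D v) * Cexp (Ci * RtoC theta0))%C /\
  psi2 = (Ci * RtoC (k * cn v (1 / 2) / D v) * Cexp (Ci * RtoC theta0))%C.
Proof.
  intros psi1 psi2 alpha k Ha Halpha H0 Hk D.
  destruct (quadrature_coordinates psi1 psi2 H0) as (p & q & theta & E1 & E2).
  assert (Hk0 : k <> 0) by (intros ->; lra).
  assert (Hmod : Cmod psi1 ^ 4 + Cmod psi2 ^ 4 = p ^ 4 + q ^ 4).
  { pose proof (sin2_cos2 theta) as Hsc. unfold Rsqr in Hsc.
    rewrite E1, E2, !Cmod_pow4, Cexp_i. unfold Cmult; simpl.
    transitivity (((p ^ 2) * (sin theta * sin theta + cos theta * cos theta)) ^ 2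
                  + ((q ^ 2) * (sin theta * sin theta + cos theta * cos theta)) ^ 2); [ring | ].
    rewrite Hsc. ring. }
  destruct (quartic_curve_parametrization (p / k) (q / k)) as (v & HP & HQ).
  { replace ((p / k) ^ 4 + (q / k) ^ 4) with ((p ^ 4 + q ^ 4) / (k ^ 2) ^ 2) by (field; exact Hk0).
    rewrite Hk, <- Hmod.
    replace (Cmod psi1 ^ 4 + Cmod psi2 ^ 4) with (alpha ^ 2 / 4) by lra. field. lra. }
  exists theta, (2 * v). replace (1 / 2 * (2 * v)) with v by field.
  cbv zeta. fold (D v) in HP, HQ.
  replace (k * sn v (1 / 2) * dn v (1 / 2) / D v) with p.
  - replace (k * cn v (1 / 2) / D v) with q; [split; assumption | ].
    transitivity (k * (q / k)); [field; exact Hk0 | rewrite HQ; unfold Rdiv; ring].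
  - transitivity (k * (p / k)); [field; exact Hk0 | rewrite HP; unfold Rdiv; ring].
Qed.

(** * Assembling the statement *)

Lemma Re_Cconj_mult : forall z w : C,
  Re (Cconj z * w)%C = Re z * Re w + Im z * Im w.
Proof. intros z w. simpl. unfold Re, Im. ring. Qed.

(** [|2 Re (conj z * w)| <= 2 |z| |w|], followed by [2 X Y <= X^2 + Y^2] for the
    squared moduli.  This is what places [m] in [[0, 1/2]]. *)
Lemma overlap_bound : forall z w : C,
  (2 * Re (Cconj z * w)%C) ^ 2 <= 2 * (Cmod z ^ 4 + Cmod w ^ 4).
Proof.
  intros z w. rewrite Re_Cconj_mult, !Cmod_pow4.
  set (X := Re z ^ 2 + Im z ^ 2). set (Y := Re w ^ 2 + Im w ^ 2).
  pose proof (pow2_ge_0 (2 * (Re z * Im w - Im z * Re w))).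
  pose proof (pow2_ge_0 (X - Y)).
  replace ((2 * (Re z * Re w + Im z * Im w)) ^ 2)
    with (4 * (X * Y) - (2 * (Re z * Im w - Im z * Re w)) ^ 2) by (unfold X, Y; ring).
  lra.
Qed.

Theorem theorem1p5 :
  forall psi1 psi2 : C, (psi1, psi2) <> (RtoC 0, RtoC 0) ->
  let alpha : R := 2 * sqrt (Cmod psi1 ^ 4 + Cmod psi2 ^ 4) in
  let calR0 : R := 2 * Re (Cconj psi1 * psi2)%C in
  let m : R := 1 / 2 - calR0 ^ 2 / alpha ^ 2 in
  0 <= m <= 1 / 2 /\
  (calR0 <> 0 ->
   exists theta0 t0 : R,
   forall A1 A2 : R -> C, is_solution psi1 psi2 A1 A2 ->
   forall tau : R,
     (A1 tau =
        RtoC (Rpower 2 (- (3 / 4)) * Rpower alpha (1 / 2))%R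
        * Cexp (Ci * RtoC theta0)
        * RtoC (sqrt (dn (alpha * tau + t0) m
                      + sqrt m * sn (alpha * tau + t0) m))%R
        * Cexp (- Ci * RtoC (calR0 / 2)%R
                * RtoC (RInt (V := R_CompleteNormedModule) (fun s : R =>
                    (1 - sqrt m * sd (alpha * s + t0) m)
                    / (1 + sqrt m * sd (alpha * s + t0) m)) 0 tau)%R))%C /\
     (A2 tau =
        RtoC (Rpower 2 (- (1 / 4)) * Rpower alpha (- (1 / 2)))%R
        * Cexp (Ci * RtoC theta0)
        * ((RtoC calR0 + Ci * RtoC (alpha * sqrt m * cn (alpha * tau + t0) m)%R)
           / RtoC (sqrt (dn (alpha * tau + t0) m
                         + sqrt m * sn (alpha * tau + t0) m))%R)
        * Cexp (- Ci * RtoC (calR0 / 2)%R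
                * RtoC (RInt (V := R_CompleteNormedModule) (fun s : R =>
                    (1 - sqrt m * sd (alpha * s + t0) m)
                    / (1 + sqrt m * sd (alpha * s + t0) m)) 0 tau)%R))%C) /\
  (calR0 = 0 ->
   exists theta0 t0 : R,
   forall A1 A2 : R -> C, is_solution psi1 psi2 A1 A2 ->
   forall tau : R,
     (A1 tau =
        RtoC (/ 2 * Rpower alpha (1 / 2))%R
        * Cexp (Ci * RtoC theta0)
        * RtoC (sn (1 / 2 * (alpha * tau + t0)) (1 / 2))%R
        * RtoC (sqrt (1 + nd (alpha * tau + t0) (1 / 2)))%R)%C /\
     (A2 tau =
        Ci * RtoC (/ 2 * Rpower alpha (1 / 2))%R
        * Cexp (Ci * RtoC theta0)
        * RtoC (cd (1 / 2 * (alpha * tau + t0)) (1 / 2))%R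
        * RtoC (sqrt (1 + nd (alpha * tau + t0) (1 / 2)))%R)%C) /\
  (forall A1 A2 : R -> C, is_solution psi1 psi2 A1 A2 ->
   forall tau : R,
     Cmod (A1 tau) ^ 4 + Cmod (A2 tau) ^ 4 = alpha ^ 2 / 4 /\
     2 * Re (Cconj (A1 tau) * A2 tau)%C = calR0).
Proof.
  intros psi1 psi2 Hpsi alpha calR0 m.
  set (S := Cmod psi1 ^ 4 + Cmod psi2 ^ 4) in *.
  assert (HS : 0 < S).
  { pose proof (pow_le _ 4 (Cmod_ge_0 psi1)). pose proof (pow_le _ 4 (Cmod_ge_0 psi2)).
    destruct (Req_dec S 0) as [h | h]; [exfalso | unfold S in *; lra].
    apply Hpsi. f_equal; apply Cmod_eq_0.
    - destruct (Cmod_ge_0 psi1) as [Hp | Hp]; [ | now symmetry].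
      apply (pow_lt _ 4) in Hp. unfold S in h. lra.
    - destruct (Cmod_ge_0 psi2) as [Hp | Hp]; [ | now symmetry].
      apply (pow_lt _ 4) in Hp. unfold S in h. lra. }
  assert (Ha : 0 < alpha) by (unfold alpha; pose proof (sqrt_lt_R0 S HS); lra).
  assert (Ha2 : alpha ^ 2 = 4 * S).
  { unfold alpha. rewrite Rpow_mult_distr, pow2_sqrt by lra. ring. }
  assert (Hinv : alpha ^ 2 * m = alpha ^ 2 / 2 - calR0 ^ 2)
    by (unfold m; field; lra).
  assert (HR0 : calR0 ^ 2 <= alpha ^ 2 / 2).
  { pose proof (overlap_bound psi1 psi2). unfold S in Ha2. fold calR0 in H. lra. }
  assert (Hm : 0 <= m <= 1 / 2).
  { pose proof (pow2_ge_0 calR0). split; nra. }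
  clearbody m.
  assert (Hroot : Rpower alpha (1 / 2) ^ 2 = alpha).
  { rewrite <- Rpower_pow by apply exp_pos. rewrite Rpower_mult.
    replace (1 / 2 * INR 2) with 1 by (simpl; field). now apply Rpower_1. }
  split; [exact Hm | split; [ | split]].
  - intros Hne.
    assert (Hm' : 0 <= m < 1 / 2).
    { split; [lra | ]. assert (0 < calR0 ^ 2) by now apply pow2_gt_0. nra. }
    set (k1 := Rpower 2 (- (3 / 4)) * Rpower alpha (1 / 2)).
    set (k2 := Rpower 2 (- (1 / 4)) * Rpower alpha (- (1 / 2))).
    assert (Hk1 : 0 < k1) by (apply Rmult_lt_0_compat; apply exp_pos).
    assert (Hk : k1 * k2 = 1 / 2).
    { unfold k1, k2.
      transitivity ((Rpower 2 (- (3 / 4)) * Rpower 2 (- (1 / 4)))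
                    * (Rpower alpha (1 / 2) * Rpower alpha (- (1 / 2)))); [ring | ].
      rewrite <- !Rpower_plus.
      replace (- (3 / 4) + - (1 / 4)) with (Ropp 1) by field.
      replace (1 / 2 + - (1 / 2)) with 0 by ring.
      rewrite Rpower_Ropp, Rpower_1, Rpower_O by lra. field. }
    assert (Hk4 : k1 ^ 4 = alpha ^ 2 / 8).
    { unfold k1. rewrite Rpow_mult_distr.
      replace (Rpower alpha (1 / 2) ^ 4) with ((Rpower alpha (1 / 2) ^ 2) ^ 2) by ring.
      rewrite Hroot, <- (Rpower_pow 4) by apply exp_pos. rewrite Rpower_mult.
      replace (- (3 / 4) * INR 4) with (- INR 3) by (simpl; field).
      rewrite Rpower_Ropp, Rpower_pow by lra. field. }
    destruct (nonzero_overlap_initial psi1 psi2 alpha calR0 m k1 k2) as (theta0 & t0 & I1 & I2);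
      try assumption; try reflexivity.
    exists theta0, t0. intros A1 A2 HA tau.
    destruct (solution_nonzero_overlap psi1 psi2 A1 A2 alpha calR0 m k1 k2 theta0 t0
                Hm' Hinv Hk1 Hk Hk4 I1 I2 HA tau) as [E1 E2].
    change (fun s : R => (1 - sqrt m * sd (alpha * s + t0) m)
                         / (1 + sqrt m * sd (alpha * s + t0) m))
      with (phase_rate alpha m t0).
    set (J := RInt (V := R_CompleteNormedModule) (phase_rate alpha m t0) 0 tau) in *.
    set (u := alpha * tau + t0) in *.
    assert (Hg : 0 < sqrt (dn u m + sqrt m * sn u m))
      by (apply sqrt_lt_R0; now apply dn_dominates_sn).
    set (g := sqrt (dn u m + sqrt m * sn u m)) in *.
    assert (Hphase : (- Ci * RtoC (calR0 / 2) * RtoC J)%C = (Ci * RtoC (- (calR0 / 2 * J)))%C).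
    { unfold Cmult, Copp; simpl. f_equal; ring. }
    unfold Rminus in E1, E2. rewrite Cexp_i_plus in E1, E2. rewrite Hphase.
    split.
    + rewrite E1, RtoC_mult. ring.
    + rewrite E2.
      replace (RtoC (k2 * calR0 / g) + Ci * RtoC (k2 * alpha * sqrt m * cn u m / g))%C
        with (RtoC k2 * ((RtoC calR0 + Ci * RtoC (alpha * sqrt m * cn u m)) / RtoC g))%C.
      * ring.
      * unfold Cdiv. rewrite <- RtoC_inv by lra.
        unfold Cmult, Cplus; simpl. f_equal; field; lra.
  - intros H0.
    set (k0 := / 2 * Rpower alpha (1 / 2)).
    assert (Hk : (k0 * sqrt 2) ^ 2 = alpha / 2).
    { unfold k0. rewrite !Rpow_mult_distr, Hroot, pow2_sqrt by lra. field. }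
    destruct (zero_overlap_initial psi1 psi2 alpha (k0 * sqrt 2)) as (theta0 & t0 & I1 & I2);
      try assumption.
    { unfold calR0 in H0. lra. }
    exists theta0, t0. intros A1 A2 HA tau.
    destruct (solution_zero_overlap psi1 psi2 A1 A2 alpha (k0 * sqrt 2) theta0 t0
                Hk I1 I2 HA tau) as [E1 E2].
    set (v := 1 / 2 * (alpha * tau + t0)) in *.
    replace (alpha * tau + t0) with (2 * v) by (unfold v; field).
    rewrite E1, E2, sqrt_one_plus_nd_double.
    pose proof (dn_pos v (1 / 2) ltac:(lra)) as Hdn.
    set (D := sqrt (1 - sn v (1 / 2) ^ 2 + sn v (1 / 2) ^ 4 / 2)).
    unfold cd. split.
    + replace (k0 * sqrt 2 * sn v (1 / 2) * dn v (1 / 2) / D)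
        with (k0 * sn v (1 / 2) * (sqrt 2 * dn v (1 / 2) / D)) by (unfold Rdiv; ring).
      rewrite !RtoC_mult. ring.
    + replace (k0 * sqrt 2 * cn v (1 / 2) / D)
        with (k0 * (cn v (1 / 2) / dn v (1 / 2)) * (sqrt 2 * dn v (1 / 2) / D)).
      * rewrite !RtoC_mult. ring.
      * transitivity (k0 * sqrt 2 * cn v (1 / 2) / D
                      * (/ dn v (1 / 2) * dn v (1 / 2))); [unfold Rdiv; ring | ].
        rewrite Rinv_l by lra. ring.
  - intros A1 A2 HA tau.
    destruct (real_system_invariants _ _ _ _ (real_system_of_solution _ _ _ _ HA) tau)
      as [He Ho].
    destruct HA as (_ & HA1 & HA2). rewrite HA1, HA2 in He, Ho.
    split.
    + rewrite !Cmod_pow4, He, Ha2. unfold S. rewrite !Cmod_pow4. field.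
    + unfold calR0. rewrite !Re_Cconj_mult. now rewrite Ho.
Qed.
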